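(* Let $\mathcal{A}$ be a quasi-abelian category equipped with a rank function and a $\Lambda$-valued slope function $\mu$, where $\Lambda$ is a totally ordered, uniquely divisible abelian group. Let $f: M \to N$ be a morphism in $W\mathcal{A}^{\mathrm{pre}}$ with $M \in W\mathcal{A}^{\mathrm{pre}}_{\mathrm{udq}}$ and $N \in W\mathcal{A}^{\mathrm{pre}}_{\mathrm{uds}}$. Then: (1) $f$ is strict in $W\mathcal{A}^{\mathrm{pre}}$, that is, the canonical morphism $\mathrm{Coim} f \to \mathrm{Im} f$ in $W\mathcal{A}^{\mathrm{pre}}$ is an isomorphism. (2) The cokernel of $f$ in $W\mathcal{A}^{\mathrm{pre}}$ is computed in $\mathrm{Fun}(\Lambda,\mathcal{A})$ (i.e. it is also the cokernel of $f$ in $\mathrm{Fun}(\Lambda,\mathcal{A})$), and it lies in $W\mathcal{A}^{\mathrm{pre}}_{\mathrm{uds}}$. Dually, $\mathrm{Ker} f \in W\mathcal{A}^{\mathrm{pre}}_{\mathrm{udq}}$.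
   Context: All categories are essentially small. In an additive category with kernels and cokernels, put $\mathrm{Coim} f = \mathrm{Coker}(\ker f)$ and $\mathrm{Im} f = \mathrm{Ker}(\mathrm{coker} f)$; $f$ is strict if the canonical morphism $\mathrm{Coim} f \to \mathrm{Im} f$ is an isomorphism. Strict monics are exactly the kernels, strict epis exactly the cokernels. Subobject = monic, quotient = epi; they are called strict if the morphism is strict. A sequence $0 \to M \xrightarrow{f} N \xrightarrow{g} P \to 0$ is short exact if $f = \ker g$ and $g = \mathrm{coker} f$. A quasi-abelian category is an additive category with kernels and cokernels in which kernels are stable under pushout and cokernels are stable under pullback. Slope functions. A rank function $\mathrm{rk}$ assigns to each isomorphism class of $\mathcal{A}$ a natural number, is additive along short exact sequences, and is nonzero on nonzero objects. A degree function $\deg$ assigns to each isomorphism class an element of $\Lambda$ and is additive along short exact sequences. $\mu = \deg/\mathrm{rk}$ (defined on nonzero objects) is a slope function if for every epi-monic $\varphi: M \to N$ in $\mathcal{A}$ one has $\mu(M) \leq \mu(N)$, with equality if and only if $\varphi$ is an isomorphism. Filtrations. $\mathrm{Fun}(\Lambda,\mathcal{A})$ is the category of functors from the totally ordered set $\Lambda$ to $\mathcal{A}$. $W\mathcal{A}^{\mathrm{pre}} \subset \mathrm{Fun}(\Lambda,\mathcal{A})$ is the full subcategory of finite ascending filtrations: functors $\lambda \mapsto W_{\leq\lambda}M$ with colimit $M$ such that each $W_{\leq\lambda}M \to M$ is a strict monic and there are finitely many breaks $\lambda_0 < \dots < \lambda_r$ such that $W_{\leq\lambda}M = 0$ for $\lambda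 < \lambda_0$, $W_{\leq\lambda}M = W_{\leq\lambda_{i-1}}M$ for $\lambda_{i-1} \leq \lambda < \lambda_i$, and $W_{\leq\lambda}M = M$ for $\lambda \geq \lambda_r$ (no breaks if $M=0$). Objects are written $(M,W)$ or $M$. Put $W_{<\lambda}M = \mathrm{colim}_{\lambda'<\lambda} W_{\leq\lambda'}M$ and $\mathrm{gr}^W_\lambda M = \mathrm{Coker}(W_{<\lambda}M \hookrightarrow W_{\leq\lambda}M)$. $W\mathcal{A}^{\mathrm{pre}}$ is an additive category with kernels and cokernels. $W\mathcal{A}^{\mathrm{pre}}_{\mathrm{uds}} \subset W\mathcal{A}^{\mathrm{pre}}$ is the full subcategory of $(M,W)$ such that for all $\lambda \in \Lambda$, all nonzero subobjects of $\mathrm{gr}^W_\lambda M$ have slope $\leq \lambda$. $W\mathcal{A}^{\mathrm{pre}}_{\mathrm{udq}} \subset W\mathcal{A}^{\mathrm{pre}}$ is the full subcategory of $(M,W)$ such that for all $\lambda$, all nonzero quotients of $\mathrm{gr}^W_\lambda M$ have slope $\geq \lambda$. *)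

(* Defs.v *)
From HB Require Import structures.
From mathcomp Require Import all_boot all_order all_algebra.
From mathcomp Require Import boolp classical_sets.

Set Implicit Arguments.
Unset Strict Implicit.
Unset Printing Implicit Defensive.

Import Order.TTheory GRing.Theory Num.Theory.
Local Open Scope classical_set_scope.
Local Open Scope ring_scope.

(* A category enriched in abelian groups. Equality of morphisms is Leibniz
   equality. *)
Record preadditive := Preadditive {
  obj :> Type;
  mor : obj -> obj -> zmodType;
  idm : forall X, mor X X;
  mcomp : forall X Y Z, mor Y Z -> mor X Y -> mor X Z;
  mcompA : forall W X Y Z (h : mor Y Z) (g : mor X Y) (f : mor W X),
    mcomp h (mcomp g f) = mcomp (mcomp h g) f;
  mcomp1m : forall X Y (f : mor X Y), mcomp (idm Y) f = f;
  mcompm1 : forall X Y (f : mor X Y), mcomp f (idm X) = f;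
  mcompDl : forall X Y Z (g g' : mor Y Z) (f : mor X Y),
    mcomp (g + g') f = mcomp g f + mcomp g' f;
  mcompDr : forall X Y Z (g : mor Y Z) (f f' : mor X Y),
    mcomp g (f + f') = mcomp g f + mcomp g f'
}.

Arguments mor {p} X Y.
Arguments idm {p} X.
Arguments mcomp {p X Y Z} g f.

Notation "g \c f" := (mcomp g f) (at level 40, left associativity).

Section Category.
Variable C : preadditive.
Implicit Types X Y Z T : C.

Definition is_mono X Y (f : mor X Y) :=
  forall T (g h : mor T X), f \c g = f \c h -> g = h.

Definition is_epi X Y (f : mor X Y) :=
  forall T (g h : mor Y T), g \c f = h \c f -> g = h.

Definition is_iso X Y (f : mor X Y) :=
  exists g : mor Y X, g \c f = idm X /\ f \c g = idm Y.

Definition isomorphic X Y := exists f : mor X Y, is_iso f.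

Definition is_zero Z :=
  (forall X, exists! f : mor X Z, True) /\ (forall X, exists! f : mor Z X, True).

Definition is_biproduct X Y P :=
  exists (i1 : mor X P) (i2 : mor Y P) (p1 : mor P X) (p2 : mor P Y),
    [/\ p1 \c i1 = idm X, p2 \c i2 = idm Y, p1 \c i2 = 0, p2 \c i1 = 0
      & i1 \c p1 + i2 \c p2 = idm P].

Definition additive_category :=
  (exists Z, is_zero Z) /\ (forall X Y, exists P, is_biproduct X Y P).

(* [is_kernel f k]: k is a kernel of f. *)
Definition is_kernel X Y (f : mor X Y) K (k : mor K X) :=
  f \c k = 0 /\
  forall T (g : mor T X), f \c g = 0 -> exists! h : mor T K, k \c h = g.

(* [is_cokernel f q]: q is a cokernel of f. *)
Definition is_cokernel X Y (f : mor X Y) Q (q : mor Y Q) :=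
  q \c f = 0 /\
  forall T (g : mor Y T), g \c f = 0 -> exists! h : mor Q T, h \c q = g.

Definition has_kernels :=
  forall X Y (f : mor X Y), exists (K : C) (k : mor K X), is_kernel f k.

Definition has_cokernels :=
  forall X Y (f : mor X Y), exists (Q : C) (q : mor Y Q), is_cokernel f q.

(* [is_coim f p]: p is the projection of X onto Coim f = Coker (ker f). *)
Definition is_coim X Y (f : mor X Y) J (p : mor X J) :=
  exists (K : C) (k : mor K X), is_kernel f k /\ is_cokernel k p.

(* [is_im f i]: i is the inclusion of Im f = Ker (coker f) into Y. *)
Definition is_im X Y (f : mor X Y) I (i : mor I Y) :=
  exists (Q : C) (q : mor Y Q), is_cokernel f q /\ is_kernel q i.

(* The canonical morphism u : Coim f -> Im f is the unique one such that
   f = i \c u \c p; the coimage and image are asserted to exist. *)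
Definition strict X Y (f : mor X Y) :=
  exists (J : C) (p : mor X J) (I : C) (i : mor I Y) (u : mor J I),
    [/\ is_coim f p, is_im f i, f = i \c u \c p & is_iso u].

Definition strict_mono X Y (f : mor X Y) := is_mono f /\ strict f.

Definition short_exact X Y Z (f : mor X Y) (g : mor Y Z) :=
  is_kernel g f /\ is_cokernel f g.

Definition is_pullback X Y Z P
    (f : mor X Z) (g : mor Y Z) (f' : mor P Y) (g' : mor P X) :=
  f \c g' = g \c f' /\
  forall T (a : mor T X) (b : mor T Y), f \c a = g \c b ->
    exists! h : mor T P, g' \c h = a /\ f' \c h = b.

Definition is_pushout X Y Z P
    (f : mor Z X) (g : mor Z Y) (f' : mor Y P) (g' : mor X P) :=
  g' \c f = f' \c g /\
  forall T (a : mor X T) (b : mor Y T), a \c f = b \c g ->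
    exists! h : mor P T, h \c g' = a /\ h \c f' = b.

Definition some_kernel X Y (f : mor X Y) :=
  exists (Z : C) (g : mor Y Z), is_kernel g f.

Definition some_cokernel X Y (f : mor X Y) :=
  exists (Z : C) (g : mor Z X), is_cokernel g f.

Definition kernels_pushout_stable :=
  forall X Y Z P (f : mor Z X) (g : mor Z Y) (f' : mor Y P) (g' : mor X P),
    is_pushout f g f' g' -> some_kernel f -> some_kernel f'.

Definition cokernels_pullback_stable :=
  forall X Y Z P (f : mor X Z) (g : mor Y Z) (f' : mor P Y) (g' : mor P X),
    is_pullback f g f' g' -> some_cokernel f -> some_cokernel f'.

Definition quasi_abelian :=
  [/\ additive_category, has_kernels, has_cokernels,
      kernels_pushout_stable & cokernels_pullback_stable].

End Category.

Section FullSubcategory.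
Variables (C : preadditive) (P : C -> Prop).

Let fobj := {X : C | P X}.
Let fmor (X Y : fobj) : zmodType := mor (sval X) (sval Y).

Definition full_subcategory : preadditive :=
  @Preadditive fobj fmor (fun X => idm (sval X))
    (fun X Y Z (g : fmor Y Z) (f : fmor X Y) => g \c f)
    (fun W X Y Z h g f => mcompA h g f)
    (fun X Y f => mcomp1m f)
    (fun X Y f => mcompm1 f)
    (fun X Y Z g g' f => mcompDl g g' f)
    (fun X Y Z g f f' => mcompDr g f f').

Definition incl (X : full_subcategory) : C := sval X.

Definition incl_mor (X Y : full_subcategory) (f : mor X Y) :
  mor (incl X) (incl Y) := f.

End FullSubcategory.

Section OrderedGroup.
Variable L : porderZmodType.

(* A porderZmodType carries no compatibility between order and addition. *)
Definition totally_ordered_group :=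
  total (<=%R : rel L) /\ (forall x y z : L, x <= y -> x + z <= y + z).

Definition uniquely_divisible :=
  forall (n : nat) (x : L), (0 < n)%N -> exists! y : L, y *+ n = x.

(* The quotient x / n, meaningful when 0 < n and L is uniquely divisible. *)
Definition divL (x : L) (n : nat) : L := xget 0 [set y : L | y *+ n = x].

End OrderedGroup.

Section Slope.
Variables (L : porderZmodType) (A : preadditive).

Definition rank_function (rk : A -> nat) :=
  [/\ forall X Y, isomorphic X Y -> rk X = rk Y,
      forall X Y Z (f : mor X Y) (g : mor Y Z),
        short_exact f g -> rk Y = (rk X + rk Z)%N
    & forall X, ~ is_zero X -> rk X <> 0%N].

Definition degree_function (deg : A -> L) :=
  (forall X Y, isomorphic X Y -> deg X = deg Y) /\
  (forall X Y Z (f : mor X Y) (g : mor Y Z),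
     short_exact f g -> deg Y = deg X + deg Z).

Definition slope (rk : A -> nat) (deg : A -> L) (X : A) : L :=
  divL (deg X) (rk X).

Definition slope_function (mu : A -> L) :=
  forall (X Y : A) (f : mor X Y), ~ is_zero X -> ~ is_zero Y ->
    is_mono f -> is_epi f ->
    mu X <= mu Y /\ (mu X = mu Y <-> is_iso f).

End Slope.

Section FunctorCategory.
Variables (L : porderZmodType) (A : preadditive).

Record functor := Functor {
  fob :> L -> A;
  fmap : forall x y : L, x <= y -> mor (fob x) (fob y);
  fmap_id : forall (x : L) (h : x <= x), fmap h = idm (fob x);
  fmap_comp : forall (x y z : L) (hxy : x <= y) (hyz : y <= z) (hxz : x <= z),
    fmap hxz = fmap hyz \c fmap hxy
}.

Arguments fmap F {x y} h : rename.

Record nat_trans (F G : functor) := NatTrans {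
  nt :> forall x : L, mor (F x) (G x);
  ntP : forall (x y : L) (h : x <= y), nt y \c fmap F h = fmap G h \c nt x
}.

Lemma nat_transP (F G : functor) (a b : nat_trans F G) :
  (forall x, a x = b x) -> a = b.
Proof.
case: a b => [a Ha] [b Hb] /= ab.
have eab : a = b by apply: functional_extensionality_dep.
by subst b; congr NatTrans; apply: Prop_irrelevance.
Qed.

Lemma mcomp0m (X Y Z : A) (f : mor X Y) : (0 : mor Y Z) \c f = 0.
Proof. by apply: (addrI (0 \c f)); rewrite -mcompDl !addr0. Qed.

Lemma mcompm0 (X Y Z : A) (g : mor Y Z) : g \c (0 : mor X Y) = 0.
Proof. by apply: (addrI (g \c 0)); rewrite -mcompDr !addr0. Qed.

Lemma mcompNm (X Y Z : A) (g : mor Y Z) (f : mor X Y) : (- g) \c f = - (g \c f).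
Proof. by apply: (addrI (g \c f)); rewrite -mcompDl !subrr mcomp0m. Qed.

Lemma mcompmN (X Y Z : A) (g : mor Y Z) (f : mor X Y) : g \c (- f) = - (g \c f).
Proof. by apply: (addrI (g \c f)); rewrite -mcompDr !subrr mcompm0. Qed.

Section NatTransGroup.
Variables F G : functor.
Implicit Types a b : nat_trans F G.

Definition nt_zero : nat_trans F G.
Proof. by exists (fun x => 0) => x y h; rewrite mcomp0m mcompm0. Defined.

Definition nt_opp a : nat_trans F G.
Proof. by exists (fun x => - a x) => x y h; rewrite mcompNm mcompmN ntP. Defined.

Definition nt_add a b : nat_trans F G.
Proof. by exists (fun x => a x + b x) => x y h; rewrite mcompDl mcompDr !ntP. Defined.

HB.instance Definition _ := gen_eqMixin (nat_trans F G).
HB.instance Definition _ := gen_choiceMixin (nat_trans F G).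

Lemma nt_addA : associative nt_add.
Proof. by move=> a b c; apply: nat_transP => x /=; rewrite addrA. Qed.

Lemma nt_addC : commutative nt_add.
Proof. by move=> a b; apply: nat_transP => x /=; rewrite addrC. Qed.

Lemma nt_add0 : left_id nt_zero nt_add.
Proof. by move=> a; apply: nat_transP => x /=; rewrite add0r. Qed.

Lemma nt_addN : left_inverse nt_zero nt_opp nt_add.
Proof. by move=> a; apply: nat_transP => x /=; rewrite addNr. Qed.

HB.instance Definition _ :=
  GRing.isZmodule.Build (nat_trans F G) nt_addA nt_addC nt_add0 nt_addN.

End NatTransGroup.

Definition nt_id (F : functor) : nat_trans F F.
Proof. by exists (fun x => idm (F x)) => x y h; rewrite mcomp1m mcompm1. Defined.

Definition nt_comp (F G H : functor) (b : nat_trans G H) (a : nat_trans F G) :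
  nat_trans F H.
Proof.
by exists (fun x => b x \c a x) => x y h; rewrite -mcompA ntP !mcompA ntP.
Defined.

Definition Fun : preadditive.
Proof.
refine (@Preadditive functor (fun F G => nat_trans F G : zmodType)
          nt_id nt_comp _ _ _ _ _) => * ; apply: nat_transP => x /=.
- exact: mcompA.
- exact: mcomp1m.
- exact: mcompm1.
- exact: mcompDl.
- exact: mcompDr.
Defined.

(* Cocones under the restriction of F to the sub-poset P of L. *)
Record cocone (F : functor) (P : set L) (M : A) := Cocone {
  leg : forall x : L, P x -> mor (F x) M;
  legP : forall (x y : L) (Px : P x) (Py : P y) (h : x <= y),
    leg Py \c fmap F h = leg Px
}.

Arguments leg {F P M} c x Px : rename.

Definition is_colimit (F : functor) (P : set L) (M : A) (c : cocone F P M) :=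
  forall (T : A) (d : cocone F P T),
    exists! h : mor M T, forall x (Px : P x), h \c leg c x Px = leg d x Px.

(* b lists the breaks in increasing order; it is empty exactly when M = 0. An
   equality of two steps means that the transition morphism is invertible. *)
Definition has_breaks (F : functor) (M : A) (c : cocone F setT M) (b : seq L) :=
  [/\ sorted <%R b,
      b = [::] <-> is_zero M
    & (0 < size b)%N ->
      [/\ forall x, x < head 0 b -> is_zero (F x),
          forall i x (h : b`_i <= x), (i.+1 < size b)%N -> x < b`_i.+1 ->
            is_iso (fmap F h)
        & forall x, last 0 b <= x -> is_iso (leg c x I)]].

Definition is_filtration (F : Fun) :=
  exists (M : A) (c : cocone F setT M),
    [/\ is_colimit c, forall x, strict_mono (leg c x I)
      & exists b : seq L, has_breaks c b].

Definition WApre : preadditive := full_subcategory is_filtration.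

(* [is_gr F x G]: G is the cokernel of the canonical morphism m from
   W_{<x} = colim_{y < x} F y to W_{<=x} = F x. *)
Definition is_gr (F : Fun) (x : L) (G : A) :=
  exists (W : A) (c : cocone F [set y | y < x] W)
         (m : mor W (fob F x)) (p : mor (fob F x) G),
    [/\ is_colimit c,
        forall y (h : y < x), m \c leg c y h = fmap F (ltW h)
      & is_cokernel m p].

Definition uds (mu : A -> L) (M : WApre) :=
  forall (x : L) (G : A), is_gr (incl M) x G ->
    forall (S : A) (s : mor S G), is_mono s -> ~ is_zero S -> mu S <= x.

Definition udq (mu : A -> L) (M : WApre) :=
  forall (x : L) (G : A), is_gr (incl M) x G ->
    forall (Q : A) (q : mor G Q), is_epi q -> ~ is_zero Q -> x <= mu Q.

End FunctorCategory.

(* Main.v *)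
Require Import Defs.
From mathcomp Require Import all_boot all_order all_algebra.
From mathcomp Require Import boolp classical_sets.

(* On each graded piece, gr M -> gr N goes from an object all of whose quotients
   have slope >= x to one all of whose subobjects have slope <= x. Its coimage
   and image are related by an epi-monic that can only increase the slope, so
   both have slope exactly x, the epi-monic is an isomorphism, and the kernel
   (cokernel) of gr f still has quotients of slope >= x (subobjects of slope
   <= x). Climbing the filtration, the connecting morphism of the snake lemma
   goes from Ker gr_x f to Coker f_{<x}, an iterated extension of objects whose
   subobjects have slope < x; hence it vanishes. So f_x is strict for every x,
   and kernels and cokernels of the steps form filtrations whose graded pieces
   are the kernels and cokernels of gr f. *)

Set Implicit Arguments.
Unset Strict Implicit.
Unset Printing Implicit Defensive.

Import Order.TTheory GRing.Theory.
Local Open Scope ring_scope.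

(** * Quasi-abelian categories *)

(** Strictness on graded pieces is not enough: an extension of strict maps can be any map at all,
    and the cokernel in [Fun] of a map of filtrations can have transition maps that are not monic.
    The same connecting morphism is responsible for both defects. It ends in the cokernel at an
    earlier step, not in a graded piece, so the induction must also carry a statement about maps
    into that cokernel; this is the second half of [strict_below]. A nonzero [L] is dense and steps
    have no immediate predecessor, so the induction counts breaks, and each [x] is compared with
    some [z < x] at or above all breaks below [x]. Duality is used inside [A]: [opcat] keeps the
    same morphism groups, so most dual statements hold by conversion. The encoding of filtrations by
    strict subobjects is not symmetric, hence at that level kernels and cokernels are treated
    separately. *)

Definition opcat (C : preadditive) : preadditive :=
  @Preadditive (obj C) (fun X Y => mor Y X) (fun X => idm X)
    (fun X Y Z g f => f \c g)
    (fun W X Y Z h g f => esym (mcompA f g h))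
    (fun X Y f => mcompm1 f)
    (fun X Y f => mcomp1m f)
    (fun X Y Z g g' f => mcompDr f g g')
    (fun X Y Z g f f' => mcompDl f f' g).

Section Preadditive.
Variable C : preadditive.
Implicit Types X Y Z T : C.

Lemma mcompBl X Y Z (g g' : mor Y Z) (f : mor X Y) :
  (g - g') \c f = g \c f - g' \c f.
Proof. by rewrite mcompDl mcompNm. Qed.

Lemma mcompBr X Y Z (g : mor Y Z) (f f' : mor X Y) :
  g \c (f - f') = g \c f - g \c f'.
Proof. by rewrite mcompDr mcompmN. Qed.

Lemma mono0P X Y (f : mor X Y) :
  (forall T (g : mor T X), f \c g = 0 -> g = 0) -> is_mono f.
Proof.
move=> f0 T g h e; apply/eqP; rewrite -subr_eq0; apply/eqP/f0.
by rewrite mcompBr e subrr.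
Qed.

Lemma mono_eq0 X Y T (f : mor X Y) (g : mor T X) :
  is_mono f -> f \c g = 0 -> g = 0.
Proof. by move=> fm e; apply: fm; rewrite e mcompm0. Qed.

Lemma kernel_mono X Y K (f : mor X Y) (k : mor K X) : is_kernel f k -> is_mono k.
Proof.
case=> fk U T g h e.
have [|l [_ lU]] := U T (k \c h); first by rewrite mcompA fk mcomp0m.
by rewrite -(lU g e) (lU h erefl).
Qed.

Lemma kernel_comp0 X Y K (f : mor X Y) (k : mor K X) : is_kernel f k -> f \c k = 0.
Proof. by case. Qed.

Lemma kernel_lift X Y K T (f : mor X Y) (k : mor K X) (g : mor T X) :
  is_kernel f k -> f \c g = 0 -> exists h, k \c h = g.
Proof. by case=> _ U /U [h [e _]]; exists h. Qed.

Lemma kernelI X Y K (f : mor X Y) (k : mor K X) :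
  f \c k = 0 -> is_mono k ->
  (forall T (g : mor T X), f \c g = 0 -> exists h, k \c h = g) -> is_kernel f k.
Proof.
move=> fk km U; split=> // T g /U [h e]; exists h; split=> // h' e'.
by apply: km; rewrite e.
Qed.

Lemma iso_mono X Y (f : mor X Y) : is_iso f -> is_mono f.
Proof.
by move=> [g [gf _]] T a b e; rewrite -(mcomp1m a) -gf -mcompA e mcompA gf mcomp1m.
Qed.

Lemma mono_section_iso X Y (f : mor X Y) (g : mor Y X) :
  is_mono f -> f \c g = idm Y -> is_iso f.
Proof.
by move=> fm fg; exists g; split=> //; apply: fm; rewrite mcompA fg mcomp1m mcompm1.
Qed.

Lemma idm_iso X : is_iso (idm X).
Proof. by exists (idm X); rewrite mcomp1m. Qed.

Lemma iso_comp X Y Z (g : mor Y Z) (f : mor X Y) :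
  is_iso g -> is_iso f -> is_iso (g \c f).
Proof.
move=> [g' [g'g gg']] [f' [f'f ff']]; exists (f' \c g'); split.
  by rewrite mcompA -(mcompA f') g'g mcompm1.
by rewrite mcompA -(mcompA g) ff' mcompm1.
Qed.

Lemma iso_cancel_r X Y Z (g : mor Y Z) (f : mor X Y) :
  is_iso (g \c f) -> is_iso f -> is_iso g.
Proof.
move=> gfi [f' [f'f ff']].
have -> : g = g \c f \c f' by rewrite -mcompA ff' mcompm1.
by apply: iso_comp => //; exists f.
Qed.

Lemma iso_cancel_l X Y Z (g : mor Y Z) (f : mor X Y) :
  is_iso (g \c f) -> is_iso g -> is_iso f.
Proof.
move=> gfi [g' [g'g gg']].
have -> : f = g' \c (g \c f) by rewrite mcompA g'g mcomp1m.
by apply: iso_comp => //; exists g.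
Qed.

Lemma kernel_unique X Y K K' (f : mor X Y) (k : mor K X) (k' : mor K' X) :
  is_kernel f k -> is_kernel f k' -> exists2 a : mor K' K, is_iso a & k \c a = k'.
Proof.
move=> hk hk'.
have [a e] := kernel_lift hk (kernel_comp0 hk').
have [a' e'] := kernel_lift hk' (kernel_comp0 hk).
exists a => //; exists a'; split.
  by apply: (kernel_mono hk'); rewrite mcompA e' e mcompm1.
by apply: (kernel_mono hk); rewrite mcompA e e' mcompm1.
Qed.

Lemma kernel_iso X Y K K' (f : mor X Y) (k : mor K X) (a : mor K' K) :
  is_kernel f k -> is_iso a -> is_kernel f (k \c a).
Proof.
move=> hk ai; have [a' [_ aa']] := ai; apply: kernelI.
- by rewrite mcompA (kernel_comp0 hk) mcomp0m.
- by move=> T g h; rewrite -!mcompA => /(kernel_mono hk) /(iso_mono ai).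
- move=> T g /(kernel_lift hk) [h <-]; exists (a' \c h).
  by rewrite mcompA -(mcompA k) aa' mcompm1.
Qed.

(** Since [g] kills [f], it factors through [q]; hence what [q] kills is killed by [g] and lifts to
    [X]. *)
Lemma kernel_of_cokernel X Y Z Q (f : mor X Y) (g : mor Y Z) (q : mor Y Q) :
  is_kernel g f -> is_cokernel f q -> is_kernel q f.
Proof.
move=> hf [qf U]; apply: kernelI => //; first exact: (kernel_mono hf).
move=> T t qt; have [h [hq _]] := U _ g (kernel_comp0 hf).
by apply: (kernel_lift hf); rewrite -hq -mcompA qt mcompm0.
Qed.

Lemma some_kernel_mono X Y (f : mor X Y) : some_kernel f -> is_mono f.
Proof. by case=> Z [g /kernel_mono]. Qed.

Lemma iso_some_kernel X Y (f : mor X Y) : is_iso f -> some_kernel f.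
Proof.
move=> fi; have [f' [f'f ff']] := fi; exists Y, 0; apply: kernelI.
- by rewrite mcomp0m.
- exact: iso_mono.
- by move=> T g _; exists (f' \c g); rewrite mcompA ff' mcomp1m.
Qed.

Lemma some_kernel_factor X Y Z (k : mor Y Z) (t : mor X Y) :
  some_kernel (k \c t) -> is_mono k -> some_kernel t.
Proof.
case=> W [g hg] km; exists W, (g \c k); apply: kernelI.
- by rewrite -mcompA (kernel_comp0 hg).
- by move=> T a b e; apply: (kernel_mono hg); rewrite -!mcompA e.
- move=> T s; rewrite -mcompA => /(kernel_lift hg) [r e]; exists r.
  by apply: km; rewrite mcompA.
Qed.

Lemma zeroP X : is_zero X <-> idm X = 0.
Proof.
split=> [[h _]|e].
  by have [f [_ fU]] := h X; rewrite -(fU (idm X) I) (fU 0 I).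
split=> Y; exists 0; split=> // f _; first by rewrite -(mcomp1m f) e mcomp0m.
by rewrite -(mcompm1 f) e mcompm0.
Qed.

Lemma zero_mor_from X Y (f : mor X Y) : is_zero X -> f = 0.
Proof. by move/zeroP=> e; rewrite -(mcompm1 f) e mcompm0. Qed.

Lemma zero_mor_to X Y (f : mor X Y) : is_zero Y -> f = 0.
Proof. by move/zeroP=> e; rewrite -(mcomp1m f) e mcomp0m. Qed.

Lemma mono_zero X Y (f : mor X Y) : is_mono f -> is_zero Y -> is_zero X.
Proof. by move=> fm Y0; apply/zeroP/fm; rewrite (zero_mor_to f Y0) !mcomp0m. Qed.

Lemma zero_iso X Y (f : mor X Y) : is_zero X -> is_zero Y -> is_iso f.
Proof.
move=> /zeroP X0 /zeroP Y0; exists 0.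
by rewrite mcomp0m mcompm0 X0 Y0.
Qed.

End Preadditive.

Section PreadditiveDual.
Variable C : preadditive.
Implicit Types X Y Z T : C.

Lemma epi_eq0 X Y T (f : mor X Y) (g : mor Y T) :
  is_epi f -> g \c f = 0 -> g = 0.
Proof. exact: (@mono_eq0 (opcat C)). Qed.

Lemma cokernel_epi X Y Q (f : mor X Y) (q : mor Y Q) : is_cokernel f q -> is_epi q.
Proof. exact: (@kernel_mono (opcat C)). Qed.

Lemma cokernel_comp0 X Y Q (f : mor X Y) (q : mor Y Q) :
  is_cokernel f q -> q \c f = 0.
Proof. by case. Qed.

Lemma cokernel_lift X Y Q T (f : mor X Y) (q : mor Y Q) (g : mor Y T) :
  is_cokernel f q -> g \c f = 0 -> exists h, h \c q = g.
Proof. exact: (@kernel_lift (opcat C)). Qed.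

Lemma cokernelI X Y Q (f : mor X Y) (q : mor Y Q) :
  q \c f = 0 -> is_epi q ->
  (forall T (g : mor Y T), g \c f = 0 -> exists h, h \c q = g) -> is_cokernel f q.
Proof. exact: (@kernelI (opcat C)). Qed.

Lemma op_iso X Y (f : mor X Y) : is_iso f -> @is_iso (opcat C) Y X f.
Proof. by case=> g [gf fg]; exists g. Qed.

Lemma iso_epi X Y (f : mor X Y) : is_iso f -> is_epi f.
Proof. by move=> /op_iso; apply: (@iso_mono (opcat C)). Qed.

Lemma cokernel_unique X Y Q Q' (f : mor X Y) (q : mor Y Q) (q' : mor Y Q') :
  is_cokernel f q -> is_cokernel f q' -> exists2 a : mor Q Q', is_iso a & a \c q = q'.
Proof.
move=> hq hq'; have [a [b [ab ba]] e] := @kernel_unique (opcat C) _ _ _ _ _ _ _ hq hq'.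
by exists a => //; exists b.
Qed.

Lemma cokernel_iso X Y Q Q' (f : mor X Y) (q : mor Y Q) (a : mor Q Q') :
  is_cokernel f q -> is_iso a -> is_cokernel f (a \c q).
Proof. by move=> hq /op_iso; apply: (@kernel_iso (opcat C)). Qed.

Lemma cokernel_of_kernel X Y Z K (f : mor X Y) (g : mor Z X) (k : mor K X) :
  is_cokernel g f -> is_kernel f k -> is_cokernel k f.
Proof. exact: (@kernel_of_cokernel (opcat C)). Qed.

Lemma some_cokernel_epi X Y (f : mor X Y) : some_cokernel f -> is_epi f.
Proof. exact: (@some_kernel_mono (opcat C)). Qed.

Lemma iso_some_cokernel X Y (f : mor X Y) : is_iso f -> some_cokernel f.
Proof. by move=> /op_iso; apply: (@iso_some_kernel (opcat C)). Qed.

Lemma op_zero X : is_zero X <-> @is_zero (opcat C) X.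
Proof. by split; case. Qed.

Lemma epi_zero X Y (f : mor X Y) : is_epi f -> is_zero X -> is_zero Y.
Proof. by move=> fe /op_zero X0; apply/op_zero/(@mono_zero (opcat C) _ _ f). Qed.

End PreadditiveDual.

Lemma quasi_abelian_op (A : preadditive) : quasi_abelian A -> quasi_abelian (opcat A).
Proof.
case=> [[[Z Z0] bp] hk hc kp cp]; split; [| by move=> X Y; apply: hc | by move=> X Y;
  apply: hk | |].
- split; first by exists Z; apply/op_zero.
  move=> X Y; have [P [i1 [i2 [p1 [p2 [e1 e2 e3 e4 e5]]]]]] := bp X Y.
  by exists P, p1, p2, i1, i2; split.
- by move=> X Y Z' P f g f' g' [e U]; apply: (cp _ _ _ _ f g f' g'); split.
- by move=> X Y Z' P f g f' g' [e U]; apply: (kp _ _ _ _ f g f' g'); split.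
Qed.

(** A self-dual form of strictness with no chosen coimage or image, suited to lifting along
    covers. *)
Definition strictly_factored (C : preadditive) (X Y : C) (f : mor X Y) :=
  exists (I : C) (p : mor X I) (i : mor I Y),
    [/\ some_cokernel p, some_kernel i & f = i \c p].

(** * Diagram chases along covers *)

Section QuasiAbelian.
Variable A : preadditive.
Hypothesis A_qa : quasi_abelian A.
Implicit Types X Y Z T : A.

Lemma kernel_exists X Y (f : mor X Y) : exists K (k : mor K X), is_kernel f k.
Proof. by case: A_qa => _ hk _ _ _; apply: hk. Qed.

Lemma cokernel_exists X Y (f : mor X Y) : exists Q (q : mor Y Q), is_cokernel f q.
Proof. by case: A_qa => _ _ hc _ _; apply: hc. Qed.

Lemma zero_exists : exists Z : A, is_zero Z.
Proof. by case: A_qa => [[]]. Qed.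

Lemma pullback_exists X Y Z (f : mor X Z) (g : mor Y Z) :
  exists P (f' : mor P Y) (g' : mor P X), is_pullback f g f' g'.
Proof.
case: A_qa => [[_ bp] _ _ _ _].
have [P [i1 [i2 [p1 [p2 [e1 e2 e3 e4 e5]]]]]] := bp X Y.
have [K [k hk]] := kernel_exists (f \c p1 - g \c p2).
exists K, (p2 \c k), (p1 \c k); split.
  apply/eqP; rewrite -subr_eq0 !mcompA -mcompBl; apply/eqP; exact: kernel_comp0.
move=> T a b eab.
have p1ab : p1 \c (i1 \c a + i2 \c b) = a.
  by rewrite mcompDr !mcompA e1 e3 mcomp1m mcomp0m addr0.
have p2ab : p2 \c (i1 \c a + i2 \c b) = b.
  by rewrite mcompDr !mcompA e2 e4 mcomp1m mcomp0m add0r.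
have [|h hE] := @kernel_lift _ _ _ _ _ _ _ (i1 \c a + i2 \c b) hk.
  by rewrite mcompBl -!mcompA p1ab p2ab eab subrr.
exists h; split; first by rewrite -!mcompA hE.
move=> h' [ea eb]; apply: (kernel_mono hk); rewrite hE -ea -eb.
by rewrite -[RHS]mcomp1m -e5 mcompDl !mcompA.
Qed.

(* Cokernels play the role of covers: diagram chases with generalized elements
   are valid after passing to such a cover. *)
Lemma cover_lift X Y T (p : mor X Y) (t : mor T Y) : some_cokernel p ->
  exists T' (c : mor T' T) (t' : mor T' X), some_cokernel c /\ p \c t' = t \c c.
Proof.
move=> pc; have [P [c [t' pb]]] := pullback_exists p t.
exists P, c, t'; split; last by case: pb.
by case: A_qa => _ _ _ _ cp; apply: (cp _ _ _ _ _ _ _ _ pb).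
Qed.

(** Pullback stability enters here. A map killing the kernel of [q \c p] descends along [p]; it
    descends further along [q] because elements in the image of [b] lift through [p] after a cover,
    and the lift falls into [K]. *)
Lemma some_cokernel_comp X Y Z (q : mor Y Z) (p : mor X Y) :
  some_cokernel q -> some_cokernel p -> some_cokernel (q \c p).
Proof.
move=> qc pc; have [B [b hb]] := qc; have [A' [a ha]] := pc.
have [K [k hk]] := kernel_exists (q \c p); exists K, k; apply: cokernelI.
- exact: kernel_comp0.
- by move=> T g h; rewrite !mcompA => /(cokernel_epi ha) /(cokernel_epi hb).
- move=> T h hk0.
  have [|r ra] := @kernel_lift _ _ _ _ _ _ _ a hk.
    by rewrite -mcompA (cokernel_comp0 ha) mcompm0.
  have [|h1 h1E] := @cokernel_lift _ _ _ _ _ _ _ h ha.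
    by rewrite -ra mcompA hk0 mcomp0m.
  have [T' [c [y [cc yE]]]] := cover_lift b pc.
  have [|s sE] := @kernel_lift _ _ _ _ _ _ _ y hk.
    by rewrite -mcompA yE mcompA (cokernel_comp0 hb) mcomp0m.
  have [|h2 h2E] := @cokernel_lift _ _ _ _ _ _ _ h1 hb.
    apply: (epi_eq0 (some_cokernel_epi cc)).
    by rewrite -mcompA -yE mcompA h1E -sE mcompA hk0 mcomp0m.
  by exists h2; rewrite mcompA h2E.
Qed.

(** As [f] is monic, [g] kills whatever [f \c g] kills, so it factors through the cokernel [f \c g];
    the factor [s] is a section of [f]. *)
Lemma mono_cover_iso X Y Z (f : mor Y Z) (g : mor X Y) :
  is_mono f -> some_cokernel (f \c g) -> is_iso f.
Proof.
move=> fm [W [j hj]].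
have gj : g \c j = 0 by apply: (mono_eq0 fm); rewrite mcompA (cokernel_comp0 hj).
have [s sE] := cokernel_lift hj gj.
apply: (mono_section_iso (g := s)) => //; apply: (cokernel_epi hj).
by rewrite -mcompA sE mcomp1m.
Qed.

(** An element of [J] killed by [v] lifts, over a cover, to an element of [X] killed by [f], hence
    coming from [K], which [p] kills. *)
Lemma coim_mono X Y K J (f : mor X Y) (k : mor K X) (p : mor X J) (v : mor J Y) :
  is_kernel f k -> is_cokernel k p -> f = v \c p -> is_mono v.
Proof.
move=> hk hp fE; apply: mono0P => T t vt.
have [|T' [c [y [cc yE]]]] := @cover_lift _ _ _ p t; first by exists K, k.
have [|r rE] := @kernel_lift _ _ _ _ _ _ _ y hk.
  by rewrite fE -mcompA yE mcompA vt mcomp0m.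
apply: (epi_eq0 (some_cokernel_epi cc)).
by rewrite -yE -rE mcompA (cokernel_comp0 hp) mcomp0m.
Qed.

Lemma coim_factor X Y (f : mor X Y) :
  exists K (k : mor K X) J (p : mor X J) (v : mor J Y),
    [/\ is_kernel f k, is_cokernel k p, f = v \c p & is_mono v].
Proof.
have [K [k hk]] := kernel_exists f; have [J [p hp]] := cokernel_exists k.
have [v vE] := cokernel_lift hp (kernel_comp0 hk).
by exists K, k, J, p, v; split=> //; apply: (coim_mono hk hp).
Qed.

(** This is how chases end: a map is a cokernel once its target is covered through it. In the
    coimage factorization [f = v \c p], the monic [v] becomes invertible by [mono_cover_iso]. *)
Lemma some_cokernel_cancel X Y Z (f : mor Y Z) (g : mor X Y) :
  some_cokernel (f \c g) -> some_cokernel f.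
Proof.
have [K [k [J [p [v [hk hp -> vm]]]]]] := coim_factor f.
rewrite -mcompA => /(mono_cover_iso vm) vi.
by apply: some_cokernel_comp; [apply: iso_some_cokernel | exists K, k].
Qed.

(** Exactness at [Y] in terms of elements: [t] factors through the image, and strictness says that
    [X] covers the image. *)
Lemma image_cover X Y Q T (f : mor X Y) (q : mor Y Q) (t : mor T Y) :
  strictly_factored f -> is_cokernel f q -> q \c t = 0 ->
  exists T' (c : mor T' T) (u : mor T' X), some_cokernel c /\ f \c u = t \c c.
Proof.
move=> [I [p [i [pc [Z [g hi]] fE]]]] hq qt.
have [|h hE] := @cokernel_lift _ _ _ _ _ _ _ g hq.
  by rewrite fE mcompA (kernel_comp0 hi) mcomp0m.
have [|v vE] := @kernel_lift _ _ _ _ _ _ _ t hi.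
  by rewrite -hE -mcompA qt mcompm0.
have [T' [c [u [cc uE]]]] := cover_lift v pc.
by exists T', c, u; split=> //; rewrite fE -mcompA uE mcompA vE.
Qed.

(** Converse to [image_cover]: it suffices to lift the universal element [i] of the image over one
    cover. *)
Lemma image_cover_factor X Y Q I T (f : mor X Y) (q : mor Y Q) (i : mor I Y)
    (c : mor T I) (u : mor T X) :
  is_cokernel f q -> is_kernel q i -> some_cokernel c -> f \c u = i \c c ->
  strictly_factored f.
Proof.
move=> hq hi cc e; have [p pE] := kernel_lift hi (cokernel_comp0 hq).
exists I, p, i; split=> //; last by exists Q, q.
apply: (@some_cokernel_cancel _ _ _ p u).
by rewrite (_ : p \c u = c) //; apply: (kernel_mono hi); rewrite mcompA pE.
Qed.

Lemma strictly_factored_image X Y Q I (f : mor X Y) (q : mor Y Q) (i : mor I Y)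
    (p : mor X I) :
  strictly_factored f -> is_cokernel f q -> is_kernel q i -> i \c p = f ->
  some_cokernel p.
Proof.
move=> ff hq hi pE.
have [T [c [u [cc uE]]]] := image_cover ff hq (kernel_comp0 hi).
apply: (@some_cokernel_cancel _ _ _ p u).
by rewrite (_ : p \c u = c) //; apply: (kernel_mono hi); rewrite mcompA pE.
Qed.

Lemma snake_kernel_cover (M' M M'' N' N N'' K K'' Q' : A)
    (m' : mor M' M) (m'' : mor M M'') (n' : mor N' N) (n'' : mor N N'')
    (f' : mor M' N') (f : mor M N) (f'' : mor M'' N'')
    (k : mor K M) (k'' : mor K'' M'') (q' : mor N' Q') (r : mor K K'') :
  short_exact m' m'' -> short_exact n' n'' ->
  f \c m' = n' \c f' -> n'' \c f = f'' \c m'' -> strictly_factored f' ->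
  is_kernel f k -> is_kernel f'' k'' -> is_cokernel f' q' ->
  (forall d : mor K'' Q', d = 0) -> k'' \c r = m'' \c k -> some_cokernel r.
Proof.
move=> [hm' hm''] [hn' hn''] e' e'' sf' hk hk'' hq' hom0 rE.
have m''c : some_cokernel m''; first by exists M', m'.
have [T1 [c1 [y [c1c yE]]]] := cover_lift k'' m''c.
have [|z zE] := @kernel_lift _ _ _ _ _ _ _ (f \c y) hn'.
  by rewrite mcompA e'' -mcompA yE mcompA (kernel_comp0 hk'') mcomp0m.
(* On the kernel of the cover [c1] the lift [y] comes from [M'], so [q' \c z] vanishes there and
   descends to a map [d : K'' -> Q']. This is the connecting morphism, which [hom0] kills. *)
have qz : q' \c z = 0.
  have [B [a ha]] := kernel_exists c1.
  have [|w wE] := @kernel_lift _ _ _ _ _ _ _ (y \c a) hm'.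
    by rewrite mcompA yE -mcompA (kernel_comp0 ha) mcompm0.
  have za : z \c a = f' \c w.
    by apply: (kernel_mono hn'); rewrite !mcompA zE -e' -!mcompA wE.
  have [D [d0 hd0]] := c1c.
  have [|d dE] := @cokernel_lift _ _ _ _ _ _ _ (q' \c z) (cokernel_of_kernel hd0 ha).
    by rewrite -mcompA za mcompA (cokernel_comp0 hq') mcomp0m.
  by rewrite -dE (hom0 d) mcomp0m.
have [T2 [c2 [u [c2c uE]]]] := image_cover sf' hq' qz.
(* Correcting the lift by an element of [M'] puts it into [Ker f] without changing its image in
   [M'']. *)
have [|t tE] := @kernel_lift _ _ _ _ _ _ _ (y \c c2 - m' \c u) hk.
  by rewrite mcompBr !mcompA e' -zE -!mcompA uE subrr.
apply: (@some_cokernel_cancel _ _ _ r t).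
rewrite (_ : r \c t = c1 \c c2); first exact: some_cokernel_comp.
apply: (kernel_mono hk''); rewrite mcompA rE -mcompA tE mcompBr !mcompA yE.
by rewrite (kernel_comp0 hm') mcomp0m subr0.
Qed.

(** Left exactness makes [r'] a kernel of [r]; as [r] is a cokernel by [snake_kernel_cover], it is
    the cokernel of its own kernel. *)
Lemma snake_kernel_exact (M' M M'' N' N N'' K' K K'' Q' : A)
    (m' : mor M' M) (m'' : mor M M'') (n' : mor N' N) (n'' : mor N N'')
    (f' : mor M' N') (f : mor M N) (f'' : mor M'' N'')
    (k' : mor K' M') (k : mor K M) (k'' : mor K'' M'') (q' : mor N' Q')
    (r' : mor K' K) (r : mor K K'') :
  short_exact m' m'' -> short_exact n' n'' ->
  f \c m' = n' \c f' -> n'' \c f = f'' \c m'' -> strictly_factored f' ->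
  is_kernel f' k' -> is_kernel f k -> is_kernel f'' k'' -> is_cokernel f' q' ->
  (forall d : mor K'' Q', d = 0) ->
  k \c r' = m' \c k' -> k'' \c r = m'' \c k -> short_exact r' r.
Proof.
move=> hM hN e' e'' sf' hk' hk hk'' hq' hom0 r'E rE.
have [D [d hd]] := snake_kernel_cover hM hN e' e'' sf' hk hk'' hq' hom0 rE.
case: hM => hm' hm''; case: hN => hn' hn''.
have kr : is_kernel r r'.
  apply: kernelI.
  - apply: (kernel_mono hk''); rewrite mcompA rE -mcompA r'E mcompA.
    by rewrite (kernel_comp0 hm') mcomp0m mcompm0.
  - apply: mono0P => T g e; apply: (mono_eq0 (kernel_mono hk')).
    apply: (mono_eq0 (kernel_mono hm')).
    by rewrite mcompA -r'E -mcompA e mcompm0.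
  - move=> T g rg.
    have [|x xE] := @kernel_lift _ _ _ _ _ _ _ (k \c g) hm'.
      by rewrite mcompA -rE -mcompA rg mcompm0.
    have [|y yE] := @kernel_lift _ _ _ _ _ _ _ x hk'.
      apply: (mono_eq0 (kernel_mono hn')).
      by rewrite mcompA -e' -mcompA xE mcompA (kernel_comp0 hk) mcomp0m.
    exists y; apply: (kernel_mono hk).
    by rewrite mcompA r'E -mcompA yE.
by split=> //; apply: (cokernel_of_kernel hd).
Qed.

End QuasiAbelian.

Lemma op_strictly_factored (C : preadditive) (X Y : C) (f : mor X Y) :
  strictly_factored f -> @strictly_factored (opcat C) Y X f.
Proof. by move=> [I [p [i [pc ik ->]]]]; exists I, i, p. Qed.

(** * Dual chases and strictness in the snake diagram *)

Section QuasiAbelianDual.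
Variable A : preadditive.
Hypothesis A_qa : quasi_abelian A.
Implicit Types X Y Z T : A.

Lemma some_kernel_comp X Y Z (g : mor Y Z) (f : mor X Y) :
  some_kernel g -> some_kernel f -> some_kernel (g \c f).
Proof.
move=> gk fk.
exact: (@some_cokernel_comp _ (quasi_abelian_op A_qa) Z Y X f g fk gk).
Qed.

Lemma im_factor X Y (f : mor X Y) :
  exists Q (q : mor Y Q) J (i : mor J Y) (v : mor X J),
    [/\ is_cokernel f q, is_kernel q i, f = i \c v & is_epi v].
Proof. exact: (@coim_factor _ (quasi_abelian_op A_qa) Y X f). Qed.

(** In the opposite category the diagram is read backwards, so strictness is asked of [f''] instead
    of [f'], while the connecting morphism still goes from [K''] to [Q']. *)
Lemma snake_cokernel_exact (M' M M'' N' N N'' Q' Q K'' Q'' : A)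
    (m' : mor M' M) (m'' : mor M M'') (n' : mor N' N) (n'' : mor N N'')
    (f' : mor M' N') (f : mor M N) (f'' : mor M'' N'')
    (q' : mor N' Q') (q : mor N Q) (q'' : mor N'' Q'') (k'' : mor K'' M'')
    (r' : mor Q' Q) (r : mor Q Q'') :
  short_exact m' m'' -> short_exact n' n'' ->
  f \c m' = n' \c f' -> n'' \c f = f'' \c m'' -> strictly_factored f'' ->
  is_cokernel f' q' -> is_cokernel f q -> is_cokernel f'' q'' -> is_kernel f'' k'' ->
  (forall d : mor K'' Q', d = 0) ->
  r' \c q' = q \c n' -> r \c q = q'' \c n'' -> short_exact r' r.
Proof.
move=> [hm' hm''] [hn' hn''] e' e'' sf'' hq' hq hq'' hk'' hom0 r'E rE.
have [||||||||||||h h'] :=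
  @snake_kernel_exact _ (quasi_abelian_op A_qa) N'' N N' M'' M M'
  Q'' Q Q' K'' n'' n' m'' m' f'' f f' q'' q q' k'' r r' => //.
exact: op_strictly_factored.
Qed.

(** For [M' = 0] and [N'' = 0] the map [f] is arbitrary, so strict outer maps alone cannot suffice.
    The vanishing of the connecting morphism makes [r'] monic, and this brings the error [z] of a
    lift of [Im f] back to [M']. *)
Lemma snake_strict (M' M M'' N' N N'' K'' Q' : A)
    (m' : mor M' M) (m'' : mor M M'') (n' : mor N' N) (n'' : mor N N'')
    (f' : mor M' N') (f : mor M N) (f'' : mor M'' N'')
    (k'' : mor K'' M'') (q' : mor N' Q') :
  short_exact m' m'' -> short_exact n' n'' ->
  f \c m' = n' \c f' -> n'' \c f = f'' \c m'' ->
  strictly_factored f' -> strictly_factored f'' ->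
  is_kernel f'' k'' -> is_cokernel f' q' ->
  (forall d : mor K'' Q', d = 0) -> strictly_factored f.
Proof.
move=> hM hN e' e'' sf' sf'' hk'' hq' hom0.
have [Q [q hq]] := cokernel_exists A_qa f.
have [Q'' [q'' hq'']] := cokernel_exists A_qa f''.
have [|r' r'E] := @cokernel_lift _ _ _ _ _ _ _ (q \c n') hq'.
  by rewrite -mcompA -e' mcompA (cokernel_comp0 hq) mcomp0m.
have [|r rE] := @cokernel_lift _ _ _ _ _ _ _ (q'' \c n'') hq.
  by rewrite -mcompA e'' mcompA (cokernel_comp0 hq'') mcomp0m.
have [hr' _] := snake_cokernel_exact hM hN e' e'' sf'' hq' hq hq'' hk'' hom0 r'E rE.
have [I [i hi]] := kernel_exists A_qa q.
have [|T1 [c1 [x [c1c xE]]]] := @image_cover _ A_qa _ _ _ _ _ _ (n'' \c i) sf'' hq''.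
  by rewrite mcompA -rE -mcompA (kernel_comp0 hi) mcompm0.
have m''c : some_cokernel m''; first by exists M', m'; case: hM.
have [T2 [c2 [y [c2c yE]]]] := cover_lift A_qa x m''c.
have [hn' _] := hN.
have [|z zE] := @kernel_lift _ _ _ _ _ _ _ (i \c (c1 \c c2) - f \c y) hn'.
  by rewrite mcompBr !mcompA e'' -!mcompA yE mcompA [f'' \c _]mcompA xE !mcompA subrr.
have qz : q' \c z = 0.
  apply: (mono_eq0 (kernel_mono hr')); rewrite mcompA r'E -mcompA zE mcompBr !mcompA.
  by rewrite (kernel_comp0 hi) (cokernel_comp0 hq) !mcomp0m subr0.
have [T3 [c3 [u [c3c uE]]]] := image_cover A_qa sf' hq' qz.
apply: (@image_cover_factor _ A_qa _ _ _ _ _ f q i (c1 \c c2 \c c3)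
  (y \c c3 + m' \c u)) => //.
  by apply: some_cokernel_comp => //; apply: some_cokernel_comp.
by rewrite mcompDr !mcompA e' -[n' \c f' \c u]mcompA uE mcompA zE mcompBl !mcompA
  addrC subrK.
Qed.

Lemma strict_factored X Y (f : mor X Y) : strict f -> strictly_factored f.
Proof.
move=> [J [p [I [i [u [[K [k [hk hp]]] [Q [q [hq hi]]] -> ui]]]]]].
exists J, p, (i \c u); split=> //; first by exists K, k.
by apply: some_kernel_comp; [exists Q, q | apply: iso_some_kernel].
Qed.

(** In the factorization of a strict monic the cokernel [p] is monic as well, hence invertible. *)
Lemma strict_monoP X Y (f : mor X Y) : strict_mono f <-> some_kernel f.
Proof.
split=> [[fm /strict_factored [I [p [i [pc ik fE]]]]]|fk].
  rewrite fE; apply: some_kernel_comp => //; apply: iso_some_kernel.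
  apply: (@mono_cover_iso _ _ _ _ p (idm X)); last by rewrite mcompm1.
  by apply: mono0P => T g pg; apply: (mono_eq0 fm); rewrite fE -mcompA pg mcompm0.
split; first exact: some_kernel_mono.
have [Z [g hf]] := fk.
have [K [k hk]] := kernel_exists A_qa f; have [Q [q hq]] := cokernel_exists A_qa f.
exists X, (idm X), X, f, (idm X); split.
- exists K, k; split=> //; have k0 := mono_eq0 (kernel_mono hf) (kernel_comp0 hk).
  apply: cokernelI; first by rewrite k0 mcompm0.
    exact/iso_epi/idm_iso.
  by move=> T h _; exists h; rewrite mcompm1.
- by exists Q, q; split=> //; apply: (kernel_of_cokernel hf).
- by rewrite !mcompm1.
- exact: idm_iso.
Qed.

End QuasiAbelianDual.

(** * Degree and rank *)

Section OrderedGroup.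
Variable L : porderZmodType.
Hypothesis L_ordered : totally_ordered_group L.
Implicit Types x y z : L.

Lemma ordered_lerD2r z x y : (x + z <= y + z) = (x <= y).
Proof.
case: L_ordered => _ mD; apply/idP/idP => [|/mD //].
by move=> /(mD _ _ (- z)); rewrite !addrK.
Qed.

Lemma ordered_lerN2 x y : (- x <= - y) = (y <= x).
Proof.
by rewrite -(ordered_lerD2r (x + y) (- x)) addKr [x + y]addrC addKr.
Qed.

Lemma ordered_lerD x y z t : x <= y -> z <= t -> x + z <= y + t.
Proof.
move=> xy zt; apply: (@le_trans _ _ (y + z)); first by rewrite ordered_lerD2r.
by rewrite ![y + _]addrC ordered_lerD2r.
Qed.

Lemma ordered_ltNge x y : (x < y) = ~~ (y <= x).
Proof.
case: L_ordered => tot _; apply/idP/idP => [/lt_geF -> //|nyx].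
have /orP[xy|yx] := tot x y; last by rewrite yx in nyx.
by rewrite lt_def xy andbT; apply: contraNneq nyx => ->.
Qed.

Lemma ordered_lerMn n x y : x <= y -> x *+ n <= y *+ n.
Proof.
by move=> xy; elim: n => [|n IHn]; rewrite ?mulr0n // !mulrS; apply: ordered_lerD.
Qed.

Hypothesis L_divisible : uniquely_divisible L.

Lemma divisible_lerMn n x y : (0 < n)%N -> (x *+ n <= y *+ n) = (x <= y).
Proof.
move=> n0; apply/idP/idP => [xy|]; last exact: ordered_lerMn.
case: L_ordered => tot _; have /orP[//|yx] := tot x y.
have e : x *+ n = y *+ n by apply: le_anti; rewrite xy ordered_lerMn.
have [z [_ zU]] := L_divisible (y *+ n) n0.
by rewrite -(zU x e) (zU y).
Qed.

Lemma divLK n x : (0 < n)%N -> divL x n *+ n = x.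
Proof.
move=> n0; have [z [zE _]] := L_divisible x n0.
by apply: (@xgetPex _ 0 [set y : L | y *+ n = x]%classic); exists z.
Qed.

End OrderedGroup.

Section KernelSlope.
Variable L : porderZmodType.
Hypothesis L_ordered : totally_ordered_group L.
Variables (A : preadditive) (rk : A -> nat) (deg : A -> L).
Hypothesis A_qa : quasi_abelian A.
Hypothesis rkD : forall (X Y Z : A) (f : mor X Y) (g : mor Y Z),
  short_exact f g -> rk Y = (rk X + rk Z)%N.
Hypothesis degD : forall (X Y Z : A) (f : mor X Y) (g : mor Y Z),
  short_exact f g -> deg Y = deg X + deg Z.
Hypothesis bim_ge : forall (l : L) (X Y : A) (u : mor X Y), is_mono u -> is_epi u ->
  l *+ rk X <= deg X -> l *+ rk Y <= deg Y.

Lemma kernel_quotients_ge (l : L) (X Y I K Q : A) (f : mor X Y) (p : mor X I)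
    (i : mor I Y) (k : mor K X) (q : mor K Q) :
  (forall (E : A) (e : mor X E), is_epi e -> l *+ rk E <= deg E) ->
  deg I <= l *+ rk I -> some_cokernel p -> is_mono i -> f = i \c p ->
  is_kernel f k -> is_epi q -> l *+ rk Q <= deg Q.
Proof.
move=> Xge Ile [D [d hd]] im fE hk qe.
have [K1 [k1 [C [c [v [hk1 hc qE vm]]]]]] := coim_factor A_qa q.
have ve : is_epi v by move=> T g h e; apply: qe; rewrite qE !mcompA e.
apply: (bim_ge vm ve).
have [E [e he]] := cokernel_exists A_qa (k \c k1).
have hkp : is_kernel p k.
  apply: kernelI; last by move=> T g pg; apply: (kernel_lift hk);
    rewrite fE -mcompA pg mcompm0.
    by apply: (mono_eq0 im); rewrite mcompA -fE (kernel_comp0 hk).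
  exact: (kernel_mono hk).
have [||W [w hw]] := @some_kernel_comp _ A_qa _ _ _ k k1.
- by exists Y, f.
- by exists Q, q.
have sK : short_exact k1 c by split=> //; apply: (kernel_of_cokernel hk1).
have sX : short_exact k p by split=> //; apply: (cokernel_of_kernel hd).
have sE : short_exact (k \c k1) e by split=> //; apply: (kernel_of_cokernel hw).
have := Xge _ _ (cokernel_epi he).
(* Additivity along the three sequences [sK], [sX], [sE] replaces the construction of the extension
   itself. *)
have eqr : (rk C + rk I)%N = rk E.
  by apply/eqP; rewrite -(eqn_add2l (rk K1)) addnA -(rkD sK) -(rkD sX) -(rkD sE).
have eqd : deg C + deg I = deg E.
  by apply: (addrI (deg K1)); rewrite addrA -(degD sK) -(degD sX) -(degD sE).
rewrite -eqr -eqd mulrnDr => h.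
rewrite -(ordered_lerD2r L_ordered (l *+ rk I)); apply: (le_trans h).
by rewrite ![deg C + _]addrC ordered_lerD2r.
Qed.

End KernelSlope.

(** * Filtrations and their breaks *)

Section Breaks.
Variable L : porderZmodType.
Hypothesis L_ordered : totally_ordered_group L.
Implicit Types (x y z : L) (b : seq L).

Lemma ordered_total x y : x <= y \/ y <= x.
Proof. by case: L_ordered => t _; apply/orP/t. Qed.

Lemma ordered_leNgt x y : (x <= y) = ~~ (y < x).
Proof. by rewrite ordered_ltNge // negbK. Qed.

Lemma max_mem b (P : pred L) :
  (forall z, z \in b -> ~~ P z) \/
  exists y, [/\ y \in b, P y & forall z, z \in b -> P z -> z <= y].
Proof.
elim: b => [|w b [IH|[y [yb Py ymax]]]]; first by left.
  have [Pw|nPw] := boolP (P w); last first.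
    by left=> z; rewrite inE => /orP[/eqP-> //|/IH].
  right; exists w; rewrite mem_head; split=> // z; rewrite inE => /orP[/eqP-> //|/IH].
  by move/negP.
right; have [/andP[Pw yw]|nw] := boolP (P w && (y <= w)).
  exists w; rewrite mem_head; split=> // z; rewrite inE => /orP[/eqP-> //|zb Pz].
  exact: le_trans (ymax z zb Pz) yw.
exists y; rewrite inE yb orbT; split=> // z; rewrite inE => /orP[/eqP->|] //;
  last exact: ymax.
by move=> Pw; move: nw; rewrite Pw /= -ordered_ltNge // => /ltW.
Qed.

(** The number of breaks up to a point is the measure for inductions along the filtration; it drops
    when a break is crossed downwards. *)
Lemma count_le_lt b x y w : w \in b -> w <= y -> x < w ->
  (count (fun z => z <= x)%R b < count (fun z => z <= y)%R b)%N.
Proof.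
move=> wb wy xw; have xy := le_trans (ltW xw) wy.
elim: b wb => // v b IH; rewrite inE => /orP[/eqP wv|/IH lt] /=.
  rewrite -wv (lt_geF xw) wy add0n add1n ltnS.
  by apply: sub_count => z /= /le_trans; apply.
rewrite -addnS; apply: leq_add => //.
by case: (boolP (v <= x)) => // vx; rewrite (le_trans vx xy).
Qed.

(* No break lies strictly between z and x, so for a filtration with breaks b
   the colimit of the F y with y < x is F z. *)
Definition precedes b z x := z < x /\ forall w, w \in b -> w < x -> w <= z.

(** An ordered group with an element having nothing below it is zero, so the second alternative
    concerns only [L = 0]. *)
Lemma predecessor b x : (exists z, precedes b z x) \/ forall z, ~ z < x.
Proof.
have [[z0 z0x]|no] := pselect (exists z, z < x); last by right=> z zx; apply: no;
  exists z.
(* The arbitrary point [z0 < x] serves when no break lies below [x]. *)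
left; have [h|[z [_ zx zmax]]] := max_mem (z0 :: b) (fun z => z < x).
  by have := h z0 (mem_head _ _); rewrite z0x.
by exists z; split=> // w wb; apply: zmax; rewrite inE wb orbT.
Qed.

End Breaks.

(** * Filtrations as functors, colimits and graded pieces *)

Section Functors.
Variable L : porderZmodType.
Hypothesis L_ordered : totally_ordered_group L.
Variable A : preadditive.
Hypothesis A_qa : quasi_abelian A.
Implicit Types (x y z : L) (b : seq L) (F G : functor L A).

Lemma fmap_irr F x y (h h' : x <= y) : fmap F h = fmap F h'.
Proof. by rewrite (bool_irrelevance h h'). Qed.

Definition constant_off b F :=
  (forall x, (forall w, w \in b -> ~~ (w <= x)) -> is_zero (F x)) /\
  (forall x y (h : x <= y), (forall w, w \in b -> w <= y -> w <= x) -> is_iso (fmap F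
    h)).

Lemma constant_off_sub b b' F :
  {subset b <= b'} -> constant_off b F -> constant_off b' F.
Proof.
move=> bb' [F0 Fi]; split=> [x h|x y h h']; first by apply: F0 => w /bb' /h.
by apply: Fi => w /bb' /h'.
Qed.

(** From [t] on the functor is constant up to isomorphism, so the legs are transition maps below [t]
    and their inverses above. Used both for all of [L] and for the points below some [x]. *)
Lemma colimit_top F (P : set L) t (Pt : P t) :
  (forall x (Px : P x) (h : t <= x), is_iso (fmap F h)) ->
  exists c : cocone F P (F t),
    [/\ is_colimit c, forall x (Px : P x) (h : x <= t), leg c Px = fmap F h &
      forall x (Px : P x) (h : t <= x), leg c Px \c fmap F h = idm (F t)].
Proof.
move=> iso.
have ex x (Px : P x) : exists g : mor (F x) (F t),
    (forall h : x <= t, g = fmap F h) /\ (forall h : t <= x, g \c fmap F h = idm (F t)).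
  have [xt|tx] := ordered_total L_ordered x t.
    exists (fmap F xt); split=> [h|h]; first exact: fmap_irr.
    by rewrite -(fmap_comp F h xt (lexx t)) fmap_id.
  have [g [gf fg]] := iso x Px tx; exists g; split=> h;
    last by rewrite (fmap_irr F h tx).
  by rewrite -[g]mcompm1 -(fmap_id F (lexx x)) (fmap_comp F h tx) mcompA gf mcomp1m.
pose l x Px := sval (cid (ex x Px)).
have l1 x Px (h : x <= t) : l x Px = fmap F h by rewrite /l; case: cid => ? [].
have l2 x Px (h : t <= x) : l x Px \c fmap F h = idm _ by rewrite /l; case: cid => ? [].
have lP x y (Px : P x) (Py : P y) (h : x <= y) : l y Py \c fmap F h = l x Px.
  have [yt|ty] := ordered_total L_ordered y t.
    by rewrite (l1 _ _ yt) (l1 _ _ (le_trans h yt)) (fmap_comp F h yt).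
  have [xt|tx] := ordered_total L_ordered x t.
    by rewrite (l1 _ _ xt) (fmap_comp F xt ty) mcompA l2 mcomp1m.
  by apply: (iso_epi (iso x Px tx)); rewrite -mcompA -(fmap_comp F _ _ ty) !l2.
exists (Cocone lP); split=> //= T d; exists (leg d Pt); split=> /= [x Px|g gE].
  have [xt|tx] := ordered_total L_ordered x t; first by rewrite (l1 _ _ xt) legP.
  by apply: (iso_epi (iso x Px tx)); rewrite -mcompA l2 mcompm1 legP.
by rewrite -(gE t Pt) (l1 _ _ (lexx t)) fmap_id mcompm1.
Qed.

Lemma colimit_zero F (P : set L) Z : is_zero Z ->
  (forall x, P x -> is_zero (F x)) -> exists c : cocone F P Z, is_colimit c.
Proof.
move=> Z0 F0.
have lP x y (Px : P x) (Py : P y) (h : x <= y) : (0 : mor (F y) Z) \c fmap F h = 0.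
  exact: mcomp0m.
exists (Cocone lP) => T d; exists 0; split=> [x Px|g _].
  by rewrite mcomp0m; apply/esym/zero_mor_from/F0.
by rewrite (zero_mor_from g Z0).
Qed.

Lemma filtration_constant_off F : is_filtration F ->
  (exists b, constant_off b F) /\ forall x y (h : x <= y), some_kernel (fmap F h).
Proof.
move=> [M [c [_ cm [b [bs bM bP]]]]]; split; last first.
  move=> x y h; apply: (@some_kernel_factor _ _ _ _ (leg c (I : [set: L]%classic y))).
    by rewrite (legP c (I : [set: L]%classic x)); apply/(strict_monoP A_qa)/cm.
  by case: (cm y).
have [b0|bn] := eqVneq b [::].
  have F0 x : is_zero (F x).
    by apply: (mono_zero (f := leg c (I : [set: L]%classic x)));
      [case: (cm x) | apply/bM].
  by exists b; split=> // x y h _; apply: zero_iso.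
have s0 : (0 < size b)%N by case: (b) bn.
have [hz hi hl] := bP s0; exists b.
have z0 x : (forall w, w \in b -> ~~ (w <= x)) -> is_zero (F x).
  move=> h; apply: hz; rewrite ordered_ltNge //; apply: h.
  by case: (b) bn => // v b' _; rewrite mem_head.
split=> // x y h noxy.
(* No break lies after [x] and up to [y], so both points belong to the step opened by the largest
   break [w] up to [x]. Their values are compared with [F w], or with the colimit if [w] is the last
   break. *)
have [no|[w [wb wx wmax]]] := max_mem L_ordered b (fun w => w <= x).
  apply: zero_iso; apply: z0 => // w wb; apply/negP => /(noxy w wb).
  exact/negP/no.
have [i ib wE] : exists2 i, (i < size b)%N & b`_i = w.
  by exists (index w b); rewrite ?index_mem ?nth_index.
have [lti|] := ltnP i.+1 (size b); last first.
  move=> gei; have wl : last 0 b <= x.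
    rewrite -nth_last (_ : (size b).-1 = i) ?wE //.
    by apply/eqP; rewrite -eqSS prednK // eqn_leq ib gei.
  apply: (iso_cancel_l (g := leg c (I : [set: L]%classic y)));
    last exact/hl/(le_trans wl).
  by rewrite (legP c (I : [set: L]%classic x)); apply: hl.
have xi : x < b`_i.+1.
  rewrite ordered_ltNge //; apply/negP => ix.
  have := wmax _ (mem_nth 0 lti) ix.
  by rewrite -wE (lt_sorted_leq_nth 0 bs) // ?inE // ltnn.
have yi : y < b`_i.+1.
  by rewrite ordered_ltNge //; apply/negP => /(noxy _ (mem_nth 0 lti));
    rewrite (lt_geF xi).
rewrite -wE in wx.
have := hi i y (le_trans wx h) lti yi; rewrite (fmap_comp F wx h) => /iso_cancel_r.
by apply; apply: hi.
Qed.

Lemma constant_off_filtration b F : constant_off b F ->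
  (forall x y (h : x <= y), some_kernel (fmap F h)) -> is_filtration F.
Proof.
move=> [F0 Fi] Fk.
pose s := sort <=%R (undup b).
have sb w : (w \in s) = (w \in b) by rewrite mem_sort mem_undup.
have ss : sorted <%R s.
  rewrite lt_sorted_uniq_le sort_uniq undup_uniq sort_sorted //.
  by case: L_ordered.
have {}F0 x : (forall w, w \in s -> ~~ (w <= x)) -> is_zero (F x).
  by move=> h; apply: F0 => w; rewrite -sb => /h.
have {}Fi x y (h : x <= y) :
    (forall w, w \in s -> w <= y -> w <= x) -> is_iso (fmap F h).
  by move=> h'; apply: Fi => w; rewrite -sb => /h'.
have [s0|sn] := eqVneq s [::].
  have Fz x : is_zero (F x) by apply: F0; rewrite s0.
  have [Z Z0] := zero_exists A_qa.
  have [c cc] := colimit_zero (F := F) (P := setT) Z0 (fun x _ => Fz x).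
  exists Z, c; split=> //; last by exists [::].
  by move=> x; apply/(strict_monoP A_qa)/iso_some_kernel/zero_iso.
have sz : (0 < size s)%N by case: (s) sn.
have lmax w : w \in s -> w <= last 0 s.
  move=> ws; rewrite -nth_last -[w in w <= _](nth_index 0 ws) (lt_sorted_leq_nth 0 ss).
  - by rewrite -ltnS prednK // index_mem.
  - by rewrite inE index_mem.
  - by rewrite inE prednK.
set t := last 0 s in lmax.
have ti x (h : t <= x) : is_iso (fmap F h).
  by apply: Fi => w ws _; apply: lmax.
have [c [cc c1 c2]] := colimit_top (F := F) (P := setT) (I : [set: L]%classic t)
  (fun x _ => ti x).
have li x : t <= x -> is_iso (leg c (I : [set: L]%classic x)).
  move=> tx; apply: (iso_cancel_r (f := fmap F tx)) => //; rewrite c2; exact: idm_iso.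
exists (F t), c; split=> //.
  move=> x; apply/(strict_monoP A_qa); have [xt|tx] := ordered_total L_ordered x t.
    by rewrite (c1 _ _ xt).
  exact/iso_some_kernel/li.
have [Ft0|Ftn] := pselect (is_zero (F t)); first by exists [::].
exists s; split=> //; first by split=> // e; rewrite e in sn.
move=> _; split=> //.
  move=> x; rewrite -nth0 => xh; apply: F0 => w ws; rewrite -ordered_ltNge //.
  apply: lt_le_trans xh _; rewrite -[w](nth_index 0 ws) (lt_sorted_leq_nth 0 ss) //.
  by rewrite inE index_mem.
move=> i x h lti xi; apply: Fi => w ws wx.
rewrite -[w](nth_index 0 ws) (lt_sorted_leq_nth 0 ss) ?inE ?index_mem //;
  last exact: ltnW.
rewrite -ltnS -(lt_sorted_ltn_nth 0 ss) ?inE ?index_mem // nth_index //.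
exact: le_lt_trans wx xi.
Qed.

(** A transition map is a finite composite of isomorphisms and of maps crossing a single break. *)
Lemma kernels_of_predecessors b F : constant_off b F ->
  (forall z x (h : z < x), precedes b z x -> some_kernel (fmap F (ltW h))) ->
  forall x y (h : x <= y), some_kernel (fmap F h).
Proof.
move=> [_ Fi] Fp x y; have [n] := ubnP (count (fun z => z <= y)%R b).
elim: n y => // n IH y lt_n xy.
have [no|[y' [yb /andP[xy' y'y] ymax]]] :=
  max_mem L_ordered b (fun w => (x < w) && (w <= y)).
  apply/iso_some_kernel/Fi => w wb wy; rewrite ordered_leNgt //; apply/negP => xw.
  by have := no w wb; rewrite xw wy.
(* Adding [x] to the breaks ensures [x <= z], so the map from [F x] factors through [F z]. *)
have [no|[z [zb zy' zmax]]] := max_mem L_ordered (x :: b) (fun w => w < y').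
  by have := no x (mem_head _ _); rewrite xy'.
have xz := zmax x (mem_head _ _) xy'.
have zy'b : precedes b z y' by split=> // w wb; apply: zmax; rewrite inE wb orbT.
rewrite (fmap_comp F (le_trans xz (ltW zy')) y'y) (fmap_comp F xz (ltW zy')).
apply: some_kernel_comp => //.
  apply/iso_some_kernel/Fi => w wb wy; have [//|y'w] := ordered_total L_ordered w y'.
  by apply: ymax => //; rewrite wy (lt_le_trans xy' y'w).
apply: some_kernel_comp => //; first exact: Fp.
by apply: IH; apply: leq_trans (count_le_lt yb y'y zy') _; rewrite -ltnS.
Qed.

(* p is a cokernel of W_{<x} -> W_{<=x}; this form avoids the colimit W_{<x}. *)
Definition gr_proj F x (B : A) (p : mor (F x) B) :=
  (forall y (h : y < x), p \c fmap F (ltW h) = 0) /\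
  forall T (g : mor (F x) T), (forall y (h : y < x), g \c fmap F (ltW h) = 0) ->
    exists! h : mor B T, h \c p = g.

Lemma gr_proj_predecessor b F z x (h : z < x) (B : A) (p : mor (F x) B) :
  constant_off b F -> precedes b z x ->
  gr_proj p <-> is_cokernel (fmap F (ltW h)) p.
Proof.
move=> [_ Fi] [_ zx].
have vanish T (g : mor (F x) T) : g \c fmap F (ltW h) = 0 ->
    forall y (h' : y < x), g \c fmap F (ltW h') = 0.
  move=> g0 y yx; have [yz|zy] := ordered_total L_ordered y z.
    by rewrite (fmap_comp F yz (ltW h)) mcompA g0 mcomp0m.
  have zyi : is_iso (fmap F zy).
    by apply: Fi => w wb wy; apply: zx => //; apply: le_lt_trans wy yx.
  apply: (epi_eq0 (iso_epi zyi)); rewrite -mcompA.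
  by rewrite -(fmap_comp F zy (ltW yx) (ltW h)).
split=> -[p0 U]; split=> [|T g g0].
- exact: p0.
- by apply: U; apply: vanish.
- exact: vanish.
- by apply: U.
Qed.

Lemma gr_proj_bottom F x (B : A) (p : mor (F x) B) : (forall z, ~ z < x) ->
  gr_proj p <-> is_iso p.
Proof.
move=> no; split=> [[_ U]|[p' [pp' p'p]]].
  have [|h [hp _]] := U _ (idm (F x)); first by move=> y yx; case: (no y yx).
  exists h; split=> //; have [|g [_ gU]] := U _ p; first by move=> y yx;
    case: (no y yx).
  by rewrite -(gU (idm B) (mcomp1m _)) (gU (p \c h)) // -mcompA hp mcompm1.
split=> [y yx|T g _]; first by case: (no y yx).
exists (g \c p'); split.
  by rewrite -mcompA pp' mcompm1.
by move=> h <-; rewrite -mcompA p'p mcompm1.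
Qed.

Lemma gr_proj_exists b F x : constant_off b F ->
  exists (B : A) (p : mor (F x) B), gr_proj p.
Proof.
move=> Fb; have [[z zx]|no] := predecessor L_ordered b x.
  have [zlx _] := zx; have [B [p hp]] := cokernel_exists A_qa (fmap F (ltW zlx)).
  by exists B, p; apply/(gr_proj_predecessor zlx p Fb zx).
by exists (F x), (idm _); apply/gr_proj_bottom => //; apply: idm_iso.
Qed.

Lemma is_gr_gr_proj F x (B : A) : is_gr F x B -> exists p : mor (F x) B, gr_proj p.
Proof.
move=> [W [c [m [p [cc mc hp]]]]]; exists p; split=> [y h|T g g0].
  by rewrite -mc mcompA (cokernel_comp0 hp) mcomp0m.
case: hp => _; apply.
have lP y z (Py : y < x) (Pz : z < x) (h : y <= z) : (0 : mor (F z) T) \c fmap F h = 0.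
  exact: mcomp0m.
(* Both [g \c m] and [0] induce the zero cocone on the [F y] with [y < x], so they coincide. *)
have [u [_ uU]] := cc T (Cocone (P := [set y | y < x]%classic) lP).
rewrite -(uU (g \c m)) => [|y yx /=]; last by rewrite -mcompA mc g0.
by apply: uU => y yx; rewrite mcomp0m.
Qed.

Lemma gr_proj_is_gr b F x (B : A) (p : mor (F x) B) : constant_off b F ->
  gr_proj p -> is_gr F x B.
Proof.
move=> Fb gp; have [[z zx]|no] := predecessor L_ordered b x.
  have [zlx zmax] := zx; have [_ Fi] := Fb.
  have iso y (Py : y < x) (h : z <= y) : is_iso (fmap F h).
    by apply: Fi => w wb wy; apply: zmax => //; apply: le_lt_trans wy Py.
  have [c [cc c1 c2]] := @colimit_top F [set y | y < x]%classic z zlx iso.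
  exists (F z), c, (fmap F (ltW zlx)), p; split=> //; last first.
    by apply/(gr_proj_predecessor zlx p Fb zx).
  move=> y yx; have [yz|zy] := ordered_total L_ordered y z.
    by rewrite (c1 _ _ yz) -(fmap_comp F yz (ltW zlx) (ltW yx)).
  apply: (iso_epi (iso y yx zy)); rewrite -mcompA c2 mcompm1.
  by rewrite -(fmap_comp F zy (ltW yx) (ltW zlx)).
have [Z Z0] := zero_exists A_qa.
have [|c cc] := @colimit_zero F [set y | y < x]%classic Z Z0; first by move=> y yx;
  case: (no y yx).
exists Z, c, 0, p; split=> //; first by move=> y yx; case: (no y yx).
have pi := proj1 (gr_proj_bottom p no) gp.
split=> [|T g _]; first exact: mcompm0.
by case: gp => _; apply=> y yx; case: (no y yx).
Qed.

Lemma gr_proj_epi (F : functor L A) x (B : A) (p : mor (F x) B) : gr_proj p -> is_epi p.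
Proof.
case=> p0 U T g h e; have [|u [_ uU]] := U _ (g \c p).
  by move=> y yx; rewrite -mcompA p0 mcompm0.
by rewrite -(uU g erefl) (uU h).
Qed.

Lemma gr_proj_lift (F : functor L A) x (B T : A) (p : mor (F x) B) (g : mor (F x) T) :
  gr_proj p -> (forall y (h : y < x), g \c fmap F (ltW h) = 0) ->
  exists h, h \c p = g.
Proof. by case=> _ U /U [h [e _]]; exists h. Qed.

Lemma functor_kernel F G (a : nat_trans F G) :
  exists (K : functor L A) (k : nat_trans K F), forall x, is_kernel (a x) (k x).
Proof.
pose K x := sval (cid (kernel_exists A_qa (a x))).
pose k x : mor (K x) (F x) := sval (cid (svalP (cid (kernel_exists A_qa (a x))))).
have hk x : is_kernel (a x) (k x) by exact: (svalP (cid (svalP (cid (kernel_exists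
  A_qa (a x)))))).
have ex x y (h : x <= y) : exists t : mor (K x) (K y), k y \c t = fmap F h \c k x.
  apply: (kernel_lift (hk y)).
  by rewrite mcompA ntP -mcompA (kernel_comp0 (hk x)) mcompm0.
pose t x y h := sval (cid (ex x y h)).
have tE x y h : k y \c t x y h = fmap F h \c k x by rewrite /t; case: cid.
have t1 x h : t x x h = idm (K x).
  by apply: (kernel_mono (hk x)); rewrite tE fmap_id mcomp1m mcompm1.
have tc x y z hxy hyz hxz : t x z hxz = t y z hyz \c t x y hxy.
  by apply: (kernel_mono (hk z)); rewrite mcompA !tE -mcompA tE mcompA -fmap_comp.
by exists (Functor t1 tc), (@NatTrans _ _ (Functor t1 tc) F k tE).
Qed.

Lemma functor_cokernel F G (a : nat_trans F G) :
  exists (Q : functor L A) (q : nat_trans G Q), forall x, is_cokernel (a x) (q x).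
Proof.
pose Q x := sval (cid (cokernel_exists A_qa (a x))).
pose q x : mor (G x) (Q x) := sval (cid (svalP (cid (cokernel_exists A_qa (a x))))).
have hq x : is_cokernel (a x) (q x) by exact: (svalP (cid (svalP (cid
  (cokernel_exists A_qa (a x)))))).
have ex x y (h : x <= y) : exists t : mor (Q x) (Q y), t \c q x = q y \c fmap G h.
  apply: (cokernel_lift (hq x)).
  by rewrite -mcompA -ntP mcompA (cokernel_comp0 (hq y)) mcomp0m.
pose t x y h := sval (cid (ex x y h)).
have tE x y h : t x y h \c q x = q y \c fmap G h by rewrite /t; case: cid.
have t1 x h : t x x h = idm (Q x).
  by apply: (cokernel_epi (hq x)); rewrite tE fmap_id mcomp1m mcompm1.
have tc x y z hxy hyz hxz : t x z hxz = t y z hyz \c t x y hxy.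
  by apply: (cokernel_epi (hq x)); rewrite -mcompA !tE mcompA tE -mcompA -fmap_comp.
by exists (Functor t1 tc), (@NatTrans _ _ G (Functor t1 tc) q (fun x y h => esym (tE
  x y h))).
Qed.

Lemma pointwise_kernel (F G K : Fun L A) (a : mor F G) (k : mor K F) :
  (forall x, is_kernel (nt a x) (nt k x)) -> is_kernel a k.
Proof.
move=> hk; apply: kernelI.
- by apply: nat_transP => x /=; apply: kernel_comp0.
- move=> T g h e; apply: nat_transP => x; apply: (kernel_mono (hk x)).
  exact: (congr1 (fun u : nat_trans T F => u x) e).
- move=> T g e.
  have e0 x : nt a x \c nt g x = 0 by apply: (congr1 (fun u : nat_trans T G => u x) e).
  pose h x := sval (cid (kernel_lift (hk x) (e0 x))).
  have hE x : nt k x \c h x = nt g x by rewrite /h; case: cid.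
  have hP x y (l : x <= y) : h y \c fmap T l = fmap K l \c h x.
    by apply: (kernel_mono (hk y)); rewrite !mcompA hE !ntP -mcompA hE.
  by exists (NatTrans hP); apply: nat_transP.
Qed.

Lemma pointwise_cokernel (F G Q : Fun L A) (a : mor F G) (q : mor G Q) :
  (forall x, is_cokernel (nt a x) (nt q x)) -> is_cokernel a q.
Proof.
move=> hq; apply: cokernelI.
- by apply: nat_transP => x /=; apply: cokernel_comp0.
- move=> T g h e; apply: nat_transP => x; apply: (cokernel_epi (hq x)).
  exact: (congr1 (fun u : nat_trans G T => u x) e).
- move=> T g e.
  have e0 x : nt g x \c nt a x = 0 by apply: (congr1 (fun u : nat_trans F T => u x) e).
  pose h x := sval (cid (cokernel_lift (hq x) (e0 x))).
  have hE x : h x \c nt q x = nt g x by rewrite /h; case: cid.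
  have hP x y (l : x <= y) : h y \c fmap Q l = fmap T l \c h x.
    by apply: (cokernel_epi (hq x)); rewrite -!mcompA hE -(ntP q) mcompA hE (ntP g).
  by exists (NatTrans hP); apply: nat_transP.
Qed.

Lemma fun_iso_pointwise (F G : Fun L A) (a : mor F G) : is_iso a -> forall x, is_iso
  (nt a x).
Proof.
move=> [g [ga ag]] x; exists (nt g x).
by split; [exact: (congr1 (fun u : nat_trans F F => u x) ga)
          | exact: (congr1 (fun u : nat_trans G G => u x) ag)].
Qed.

End Functors.

(** * Pointwise kernels and cokernels of maps of filtrations *)

Section PointwiseKernels.
Variable L : porderZmodType.
Variable A : preadditive.
Hypothesis A_qa : quasi_abelian A.
Variables (M N : functor L A) (a : nat_trans M N) (b : seq L).
Hypotheses (Mb : constant_off b M) (Nb : constant_off b N).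

Lemma kernel_constant_off (K : functor L A) (k : nat_trans K M) :
  (forall x, is_kernel (a x) (k x)) -> constant_off b K.
Proof.
move=> hk; case: Mb => M0 Mi; case: Nb => N0 Ni; split=> [x /M0|x y h hb].
  exact: mono_zero (kernel_mono (hk x)).
have Mxy := Mi _ _ h hb; have Nxy := Ni _ _ h hb.
have hk' : is_kernel (a y) (fmap M h \c k x).
  apply: kernelI.
  - by rewrite mcompA ntP -mcompA (kernel_comp0 (hk x)) mcompm0.
  - by move=> T u v; rewrite -!mcompA => /(iso_mono Mxy) /(kernel_mono (hk x)).
  - move=> T t at0; case: (Mxy) => m [_ hm].
    have [|s sE] := @kernel_lift _ _ _ _ _ _ _ (m \c t) (hk x).
      apply: (mono_eq0 (iso_mono Nxy)).
      by rewrite mcompA -ntP -mcompA [_ \c (m \c t)]mcompA hm mcomp1m.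
    by exists s; rewrite -mcompA sE mcompA hm mcomp1m.
have [i ii iE] := kernel_unique (hk y) hk'.
by rewrite (_ : fmap K h = i) //; apply: (kernel_mono (hk y)); rewrite ntP iE.
Qed.

Lemma cokernel_constant_off (Q : functor L A) (q : nat_trans N Q) :
  (forall x, is_cokernel (a x) (q x)) -> constant_off b Q.
Proof.
move=> hq; case: Mb => M0 Mi; case: Nb => N0 Ni; split=> [x /N0|x y h hb].
  exact: epi_zero (cokernel_epi (hq x)).
have Mxy := Mi _ _ h hb; have Nxy := Ni _ _ h hb.
have hq' : is_cokernel (a x) (q y \c fmap N h).
  apply: cokernelI.
  - by rewrite -mcompA -ntP mcompA (cokernel_comp0 (hq y)) mcomp0m.
  - by move=> T u v; rewrite !mcompA => /(iso_epi Nxy) /(cokernel_epi (hq y)).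
  - move=> T t ta0; case: (Nxy) => n [hn _].
    have [|s sE] := @cokernel_lift _ _ _ _ _ _ _ (t \c n) (hq y).
      apply: (epi_eq0 (iso_epi Mxy)).
      by rewrite -mcompA ntP mcompA -[t \c n \c _]mcompA hn mcompm1.
    by exists s; rewrite mcompA sE -mcompA hn mcompm1.
have [i ii iE] := cokernel_unique (hq x) hq'.
by rewrite (_ : fmap Q h = i) //; apply: (cokernel_epi (hq x)); rewrite -ntP iE.
Qed.

Hypothesis Mk : forall x y (h : x <= y), some_kernel (fmap M h).

(** Kernels inherit strict transition maps from [M]; for cokernels the analogue,
    [cokernel_predecessor], depends on the slopes. *)
Lemma kernel_some_kernel (K : functor L A) (k : nat_trans K M) :
  (forall x, is_kernel (a x) (k x)) ->
  forall x y (h : x <= y), some_kernel (fmap K h).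
Proof.
move=> hk x y h; apply: (@some_kernel_factor _ _ _ _ (k y)); last exact: kernel_mono.
by rewrite ntP; apply: some_kernel_comp => //; exists (N x), (a x).
Qed.

End PointwiseKernels.

(** * Slopes *)

Section Slopes.
Variable L : porderZmodType.
Hypothesis L_ordered : totally_ordered_group L.
Hypothesis L_divisible : uniquely_divisible L.
Variables (A : preadditive) (rk : A -> nat) (deg : A -> L).
Hypothesis A_qa : quasi_abelian A.
Hypothesis rk_rank : rank_function rk.
Hypothesis deg_degree : degree_function deg.
Hypothesis slope_slope : slope_function (slope rk deg).
Implicit Types (l x y z : L) (X Y : A).

Lemma zero_short_exact X : is_zero X -> short_exact (idm X) (idm X).
Proof.
move=> X0; split; [apply: kernelI | apply: cokernelI];
  try exact: (zero_mor_to _ X0); try exact/iso_mono/idm_iso; try exact/iso_epi/idm_iso.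
  by move=> T g _; exists g; rewrite mcomp1m.
by move=> T g _; exists g; rewrite mcompm1.
Qed.

Lemma zero_rank X : is_zero X -> rk X = 0%N.
Proof.
move=> X0; case: rk_rank => _ rkD _.
by have /eqP := rkD _ _ _ _ _ (zero_short_exact X0);
  rewrite -{1}[rk X]addn0 eqn_add2l => /eqP <-.
Qed.

Lemma zero_degree X : is_zero X -> deg X = 0.
Proof.
move=> X0; case: deg_degree => _ degD.
by have /eqP := degD _ _ _ _ _ (zero_short_exact X0); rewrite -subr_eq subrr => /eqP <-.
Qed.

Lemma rank_gt0 X : ~ is_zero X -> (0 < rk X)%N.
Proof. by case: rk_rank => _ _ h /h /eqP; rewrite lt0n. Qed.

Lemma le_slopeE l X : ~ is_zero X -> (l <= slope rk deg X) = (l *+ rk X <= deg X).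
Proof.
by move=> /rank_gt0 r0; rewrite -(divisible_lerMn L_ordered L_divisible _ _ r0) divLK.
Qed.

Lemma slope_leE l X : ~ is_zero X -> (slope rk deg X <= l) = (deg X <= l *+ rk X).
Proof.
by move=> /rank_gt0 r0; rewrite -(divisible_lerMn L_ordered L_divisible _ _ r0) divLK.
Qed.

Lemma zero_deg_bounds l X : is_zero X -> l *+ rk X <= deg X <= l *+ rk X.
Proof. by move=> X0; rewrite zero_rank // zero_degree // mulr0n lexx. Qed.

Lemma bimorphism_ge l X Y (u : mor X Y) : is_mono u -> is_epi u ->
  l *+ rk X <= deg X -> l *+ rk Y <= deg Y.
Proof.
move=> um ue Xge.
have [Y0|Yn] := pselect (is_zero Y); first by case/andP: (zero_deg_bounds l Y0).
have Xn : ~ is_zero X by move=> /(epi_zero ue).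
have [le _] := slope_slope Xn Yn um ue.
by rewrite -le_slopeE //; apply: le_trans le; rewrite le_slopeE.
Qed.

Lemma bimorphism_le l X Y (u : mor X Y) : is_mono u -> is_epi u ->
  deg Y <= l *+ rk Y -> deg X <= l *+ rk X.
Proof.
move=> um ue Yle.
have [X0|Xn] := pselect (is_zero X); first by case/andP: (zero_deg_bounds l X0).
have Yn : ~ is_zero Y by move=> /(mono_zero um).
have [le _] := slope_slope Xn Yn um ue.
by rewrite -slope_leE //; apply: le_trans le _; rewrite slope_leE.
Qed.

Lemma bimorphism_iso l X Y (u : mor X Y) : is_mono u -> is_epi u ->
  l *+ rk X <= deg X -> deg Y <= l *+ rk Y -> is_iso u.
Proof.
move=> um ue Xge Yle.
have [X0|Xn] := pselect (is_zero X); first exact: (zero_iso u X0 (epi_zero ue X0)).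
have Yn : ~ is_zero Y by move=> /(mono_zero um).
have [le [eqi _]] := slope_slope Xn Yn um ue.
apply/eqi/le_anti; rewrite le /=; apply: (@le_trans _ _ l); first by rewrite slope_leE.
by rewrite le_slopeE.
Qed.

Lemma bimorphism_zero l l' X Y (u : mor X Y) : is_mono u -> is_epi u -> l' < l ->
  l *+ rk X <= deg X -> deg Y <= l' *+ rk Y -> is_zero X.
Proof.
move=> um ue l'l Xge Yle; apply: contrapT => Xn.
have Yn : ~ is_zero Y by move=> /(mono_zero um).
have [le _] := slope_slope Xn Yn um ue.
suff: l <= l' by rewrite (lt_geF l'l).
rewrite -le_slopeE // in Xge; rewrite -slope_leE // in Yle.
exact: le_trans Xge (le_trans le Yle).
Qed.

(* The bound l <= mu Q with denominators cleared: it also holds for Q = 0. *)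
Definition quotients_ge l X :=
  forall Q (q : mor X Q), is_epi q -> l *+ rk Q <= deg Q.

Definition subobjects_le l X :=
  forall S (s : mor S X), is_mono s -> deg S <= l *+ rk S.

(** The map [u] is monic because [i \c u] is the monic part of the coimage factorization, and epic
    because [u \c p] is the epic part of the image factorization. *)
Lemma canonical_factor X Y (f : mor X Y) :
  exists C (p : mor X C) I (i : mor I Y) (u : mor C I),
    [/\ some_cokernel p, some_kernel i, f = i \c u \c p, is_mono u & is_epi u].
Proof.
have [K [k [C [p [v [hk hp fE vm]]]]]] := coim_factor A_qa f.
have [Q [q [I [i [w [hq hi fE' we]]]]]] := im_factor A_qa f.
have pe := cokernel_epi hp.
have [|u uE] := @kernel_lift _ _ _ _ _ _ _ v hi.
  by apply: (epi_eq0 pe); rewrite -mcompA -fE (cokernel_comp0 hq).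
exists C, p, I, i, u; split; [by exists K, k | by exists Q, q | by rewrite uE | |].
  by move=> T g h e; apply: vm; rewrite -uE -!mcompA e.
have upE : u \c p = w by apply: (kernel_mono hi); rewrite mcompA uE -fE.
by move=> T g h e; apply: we; rewrite -upE !mcompA e.
Qed.

Lemma semistable_hom_zero l l' X Y (f : mor X Y) :
  l' < l -> quotients_ge l X -> subobjects_le l' Y -> f = 0.
Proof.
move=> l'l Xge Yle; have [C [p [I [i [u [pc ik -> um ue]]]]]] := canonical_factor f.
have C0 := bimorphism_zero um ue l'l (Xge _ _ (some_cokernel_epi pc))
  (Yle _ _ (some_kernel_mono ik)).
by rewrite -mcompA [u \c p](_ : _ = 0) ?mcompm0 // (zero_mor_to p C0) mcompm0.
Qed.

Lemma semistable_factor l X Y (f : mor X Y) :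
  quotients_ge l X -> subobjects_le l Y ->
  exists I (p : mor X I) (i : mor I Y),
    [/\ some_cokernel p, some_kernel i, f = i \c p & deg I = l *+ rk I].
Proof.
move=> Xge Yle; have [C [p [I [i [u [pc ik fE um ue]]]]]] := canonical_factor f.
have Cge := Xge _ _ (some_cokernel_epi pc); have Ile := Yle _ _ (some_kernel_mono ik).
have ui := bimorphism_iso um ue Cge Ile.
exists I, (u \c p), i; split=> //; last 2 [by rewrite mcompA].
  by apply: some_cokernel_comp => //; apply: iso_some_cokernel.
by apply: le_anti; rewrite Ile (bimorphism_ge um ue).
Qed.

Lemma semistable_strict l X Y (f : mor X Y) :
  quotients_ge l X -> subobjects_le l Y -> strictly_factored f.
Proof.
by move=> Xge Yle; have [I [p [i [pc ik fE _]]]] := semistable_factor f Xge Yle;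
  exists I, p, i.
Qed.

Lemma semistable_kernel l X Y K (f : mor X Y) (k : mor K X) :
  quotients_ge l X -> subobjects_le l Y -> is_kernel f k -> quotients_ge l K.
Proof.
move=> Xge Yle hk Q q qe.
have [I [p [i [pc ik fE Ieq]]]] := semistable_factor f Xge Yle.
case: rk_rank => _ rkD _; case: deg_degree => _ degD.
apply: (kernel_quotients_ge L_ordered A_qa rkD degD bimorphism_ge Xge _ pc
  (some_kernel_mono ik) fE hk qe).
by rewrite Ieq.
Qed.

(** In [opcat A] with degree [- deg], upper bounds by [l] on subobjects become lower bounds by [- l]
    on quotients. *)
Lemma semistable_cokernel l X Y Q (f : mor X Y) (q : mor Y Q) :
  quotients_ge l X -> subobjects_le l Y -> is_cokernel f q -> subobjects_le l Q.
Proof.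
move=> Xge Yle hq S s sm.
have [I [p [i [pc ik fE Ieq]]]] := semistable_factor f Xge Yle.
case: rk_rank => _ rkD _; case: deg_degree => _ degD.
have bnd (Z : A) : ((- l) *+ rk Z <= - deg Z) = (deg Z <= l *+ rk Z).
  by rewrite mulNrn ordered_lerN2.
rewrite -bnd; apply: (@kernel_quotients_ge _ L_ordered (opcat A) rk (fun Z => - deg Z)
  (quasi_abelian_op A_qa) _ _ _ (- l) Y X I Q S f i p q s) => //.
- by move=> X' Y' Z g h [hh hg]; rewrite addnC; apply: (rkD _ _ _ h g).
- by move=> X' Y' Z g h [hh hg]; rewrite -opprD addrC; congr (- _);
    apply: (degD _ _ _ h g).
(* Reversing [u] and changing the sign of the degree turns [bim_ge] into [bimorphism_le] at
   [- l']. *)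
- move=> l' X' Y' u um ue.
  have e (Z : A) : (l' *+ rk Z <= - deg Z) = (deg Z <= (- l') *+ rk Z).
    by rewrite -{1}[l']opprK [(- - l') *+ _]mulNrn ordered_lerN2.
  by rewrite !e; apply: (@bimorphism_le (- l') Y' X' u ue um).
- by move=> E e em; rewrite (bnd E); exact: (Yle E e em).
- by rewrite Ieq mulNrn.
- exact: (some_cokernel_epi pc).
Qed.

(** * Strictness along the filtration *)

Variables (M N : functor L A) (a : nat_trans M N) (b : seq L).
Hypotheses (Mb : constant_off b M) (Nb : constant_off b N).
Hypothesis Mk : forall x y (h : x <= y), some_kernel (fmap M h).
Hypothesis Nk : forall x y (h : x <= y), some_kernel (fmap N h).
Hypothesis Mge : forall x (B : A) (p : mor (M x) B), gr_proj p -> quotients_ge x B.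
Hypothesis Nle : forall x (B : A) (p : mor (N x) B), gr_proj p -> subobjects_le x B.

Lemma gr_map x (B B' : A) (p : mor (M x) B) (p' : mor (N x) B') :
  gr_proj p -> gr_proj p' -> exists g, g \c p = p' \c a x.
Proof.
move=> hp [p'0 _]; apply: gr_proj_lift => // y h.
by rewrite -mcompA ntP mcompA p'0 mcomp0m.
Qed.

(* The second half says that Coker (a x) is an iterated extension of objects
   whose subobjects have slope at most x. *)
Definition strict_below x :=
  strictly_factored (a x) /\
  forall l (T Q : A) (q : mor (N x) Q) (h : mor T Q),
    x < l -> quotients_ge l T -> is_cokernel (a x) q -> h = 0.

(** The snake diagram for the passage from [z] to [x]. The last clause is the second half of
    [strict_below z] at [l = x], applied to [Ker g], whose quotients have slope at least [x > z]. *)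
Lemma predecessor_sequences z x (h : z < x) : precedes b z x -> strict_below z ->
  exists (B B' : A) (p : mor (M x) B) (p' : mor (N x) B') (g : mor B B'),
    [/\ short_exact (fmap M (ltW h)) p, short_exact (fmap N (ltW h)) p',
        p' \c a x = g \c p &
        [/\ quotients_ge x B, subobjects_le x B' &
        forall (K Q : A) (k : mor K B) (q : mor (N z) Q) (d : mor K Q),
          is_kernel g k -> is_cokernel (a z) q -> d = 0]].
Proof.
move=> zx [_ hom0].
have [B [p hp]] := cokernel_exists A_qa (fmap M (ltW h)).
have [B' [p' hp']] := cokernel_exists A_qa (fmap N (ltW h)).
have gp := proj2 (gr_proj_predecessor L_ordered h p Mb zx) hp.
have gp' := proj2 (gr_proj_predecessor L_ordered h p' Nb zx) hp'.
have [g gE] := gr_map gp gp'.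
exists B, B', p, p', g; split=> //.
- by split=> //; have [W [w hw]] := Mk (ltW h); apply: (kernel_of_cokernel hw).
- by split=> //; have [W [w hw]] := Nk (ltW h); apply: (kernel_of_cokernel hw).
- split; [exact: Mge gp | exact: Nle gp' |].
  move=> K Q k q d hk hq; apply: (hom0 x _ _ q) => //.
  apply: (semistable_kernel (Mge gp) (Nle gp') hk).
Qed.

Lemma strict_below_all x : strict_below x.
Proof.
have [n] := ubnP (count (fun z => z <= x)%R b); elim: n x => // n IH x lt_n.
have [no|[y [yb yx ymax]]] := max_mem L_ordered b (fun w => w <= x).
  have M0 : is_zero (M x) by case: Mb => M0 _; apply: M0.
  have N0 : is_zero (N x) by case: Nb => N0 _; apply: N0.
  split.
    have ai := zero_iso (a x) M0 N0; exists (N x), (a x), (idm _).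
    split; [exact: iso_some_cokernel | exact/iso_some_kernel/idm_iso |].
    by rewrite mcomp1m.
  by move=> l T Q q h _ _ hq; apply/zero_mor_to/(epi_zero (cokernel_epi hq)).
have fixed w : w \in b -> w <= x -> w <= y by move=> wb; apply: ymax.
have Mi : is_iso (fmap M yx) by case: Mb => _; apply.
have Ni : is_iso (fmap N yx) by case: Nb => _; apply.
(* Up to isomorphism [a x] is [a y], so only the break [y] has to be treated. *)
suff: strict_below y.
  move=> [[I [p [i [pc ik aE]]]] hom0]; split.
    have [m [hm' hm]] := Mi; exists I, (p \c m), (fmap N yx \c i); split.
    - apply: some_cokernel_comp => //; apply: iso_some_cokernel.
      by exists (fmap M yx).
    - by apply: some_kernel_comp => //; apply: iso_some_kernel.
    - by rewrite mcompA -[_ \c i \c p]mcompA -aE -ntP -mcompA hm mcompm1.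
  move=> l T Q q h xl Tge hq.
  apply: (hom0 l _ _ (q \c fmap N yx)) => //; first exact: le_lt_trans yx xl.
  apply: cokernelI.
  - by rewrite -mcompA -ntP mcompA (cokernel_comp0 hq) mcomp0m.
  - by move=> T' u v; rewrite !mcompA => /(iso_epi Ni) /(cokernel_epi hq).
  - move=> T' t ta0; have [m [hm _]] := Ni.
    have [|s sE] := @cokernel_lift _ _ _ _ _ _ _ (t \c m) hq.
      apply: (epi_eq0 (iso_epi Mi)).
      by rewrite -mcompA ntP mcompA -[t \c m \c _]mcompA hm mcompm1.
    by exists s; rewrite mcompA sE -mcompA hm mcompm1.
(* With nothing below [y], the objects [M y] and [N y] are their own graded pieces. *)
have [[z zy]|no] := predecessor L_ordered b y; last first.
  have idp (F : functor L A) : gr_proj (idm (F y)) by apply/gr_proj_bottom => //;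
    apply: idm_iso.
  have Mge' := Mge (idp M); have Nle' := Nle (idp N).
  split.
    exact: (semistable_strict _ Mge' Nle').
  move=> l T Q q h yl Tge hq.
  apply: (semistable_hom_zero _ yl Tge).
  exact: (semistable_cokernel Mge' Nle' hq).
have [zly _] := zy.
have sz : strict_below z.
  apply: IH; rewrite -ltnS; apply: leq_trans lt_n; rewrite ltnS.
  exact: (count_le_lt yb yx zly).
have [B [B' [p [p' [g [sM sN gE [Bge Ble hom0]]]]]]] := predecessor_sequences zly zy sz.
have [sfz homz] := sz.
have sfg := semistable_strict g Bge Ble.
have [K'' [k'' hk'']] := kernel_exists A_qa g.
have [Q' [q' hq']] := cokernel_exists A_qa (a z).
have hom0' (d : mor K'' Q') : d = 0 by apply: (hom0 _ _ _ _ d hk'' hq').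
have e' := ntP a (ltW zly).
split; first exact: (snake_strict A_qa sM sN e' gE sfz sfg hk'' hq' hom0').
move=> l T Q q h yl Tge hq.
have [Q'' [q'' hq'']] := cokernel_exists A_qa g.
have [|r' r'E] := @cokernel_lift _ _ _ _ _ _ _ (q \c fmap N (ltW zly)) hq'.
  by rewrite -mcompA -e' mcompA (cokernel_comp0 hq) mcomp0m.
have [|r rE] := @cokernel_lift _ _ _ _ _ _ _ (q'' \c p') hq.
  by rewrite -mcompA gE mcompA (cokernel_comp0 hq'') mcomp0m.
have [hr' _] := snake_cokernel_exact A_qa sM sN e' gE sfg hq' hq hq'' hk'' hom0' r'E rE.
(* The component of [h] in [Coker g] vanishes since [y < l]; so [h] comes from a map to
   [Coker (a z)], which is zero by induction. *)
have rh : r \c h = 0.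
  apply: (semistable_hom_zero _ yl Tge).
  exact: (semistable_cokernel Bge Ble hq'').
have [h' <-] := kernel_lift hr' rh.
by rewrite (homz l _ _ _ h' (lt_trans zly yl) Tge hq') mcompm0.
Qed.

(** The left-hand map of the snake sequence of cokernels is a kernel; this is why the cokernel in
    [Fun] is a filtration. *)
Lemma cokernel_predecessor (Q : functor L A) (q : nat_trans N Q) :
  (forall x, is_cokernel (a x) (q x)) ->
  forall z x (h : z < x), precedes b z x -> some_kernel (fmap Q (ltW h)).
Proof.
move=> hq z x h zx; have sz := strict_below_all z.
have [B [B' [p [p' [g [sM sN gE [Bge Ble hom0]]]]]]] := predecessor_sequences h zx sz.
have sfg := semistable_strict g Bge Ble.
have [K'' [k'' hk'']] := kernel_exists A_qa g.
have [Q'' [q'' hq'']] := cokernel_exists A_qa g.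
have [|r rE] := @cokernel_lift _ _ _ _ _ _ _ (q'' \c p') (hq x).
  by rewrite -mcompA gE mcompA (cokernel_comp0 hq'') mcomp0m.
have [] // :=
  snake_cokernel_exact A_qa sM sN (ntP a (ltW h)) gE sfg (hq z) (hq x) hq'' hk''
  (fun d => hom0 _ _ _ _ d hk'' (hq z)) (esym (ntP q (ltW h))) rE.
by move=> hr' _; exists Q'', r.
Qed.

Lemma kernel_gr_ge (K : functor L A) (k : nat_trans K M) x (B : A) (p : mor (K x) B) :
  (forall x, is_kernel (a x) (k x)) -> gr_proj p -> quotients_ge x B.
Proof.
move=> hk gp.
have transport (C : A) (i : mor C B) : is_iso i -> quotients_ge x C ->
    quotients_ge x B.
  move=> ii Cge Q e ee; apply: (Cge Q (e \c i)) => T u v.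
  by rewrite !mcompA => /(iso_epi ii) /ee.
have Kb := kernel_constant_off Mb Nb hk.
have [[z zx]|no] := predecessor L_ordered b x; last first.
  have idp (F : functor L A) : gr_proj (idm (F x)) by apply/gr_proj_bottom => //;
    apply: idm_iso.
  have pi := proj1 (gr_proj_bottom p no) gp.
  apply: (transport _ p pi).
  exact: (semistable_kernel (Mge (idp M)) (Nle (idp N)) (hk x)).
have [h _] := zx; have sz := strict_below_all z.
have [C [C' [s [s' [g [sM sN gE [Cge Cle hom0]]]]]]] := predecessor_sequences h zx sz.
have [K'' [k'' hk'']] := kernel_exists A_qa g.
have [Q' [q' hq']] := cokernel_exists A_qa (a z).
have [|r rE] := @kernel_lift _ _ _ _ _ _ _ (s \c k x) hk''.
  by rewrite mcompA -gE -mcompA (kernel_comp0 (hk x)) mcompm0.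
have [_ hr] :=
  snake_kernel_exact A_qa sM sN (ntP a (ltW h)) gE (proj1 sz) (hk z) (hk x) hk''
  hq' (fun d => hom0 _ _ _ _ d hk'' hq') (ntP k (ltW h)) rE.
have hp := proj1 (gr_proj_predecessor L_ordered h p Kb zx) gp.
have [i ii _] := cokernel_unique hr hp.
apply: (transport _ i ii).
exact: (semistable_kernel Cge Cle hk'').
Qed.

(** Graded pieces are themselves cokernels and so commute with cokernels: universal properties alone
    exhibit [B] as the cokernel of [g]. *)
Lemma cokernel_gr_le (Q : functor L A) (q : nat_trans N Q) x (B : A) (p : mor (Q x) B) :
  (forall x, is_cokernel (a x) (q x)) -> gr_proj p -> subobjects_le x B.
Proof.
move=> hq gp.
have [C [s gs]] := gr_proj_exists L_ordered A_qa x Mb.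
have [C' [s' gs']] := gr_proj_exists L_ordered A_qa x Nb.
have [g gE] := gr_map gs gs'.
have [|u uE] := @gr_proj_lift _ _ _ _ _ _ _ (p \c q x) gs'.
  by move=> y h; rewrite -mcompA ntP mcompA; case: gp => -> _; rewrite mcomp0m.
apply: (semistable_cokernel (Mge gs) (Nle gs') (f := g) (q := u)).
apply: cokernelI.
- apply: (epi_eq0 (gr_proj_epi gs)).
  by rewrite -mcompA gE mcompA uE -mcompA (cokernel_comp0 (hq x)) mcompm0.
- move=> T v w e; apply: (gr_proj_epi gp); apply: (cokernel_epi (hq x)).
  by rewrite -!mcompA -uE !mcompA e.
- move=> T t tg0.
  have [|v vE] := @cokernel_lift _ _ _ _ _ _ _ (t \c s') (hq x).
    by rewrite -mcompA -gE mcompA tg0 mcomp0m.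
  have [|w wE] := @gr_proj_lift _ _ _ _ _ _ _ v gp.
    move=> y h; apply: (epi_eq0 (cokernel_epi (hq y))).
    by rewrite -mcompA -ntP mcompA vE -mcompA; case: gs' => -> _; rewrite mcompm0.
  exists w; apply: (gr_proj_epi gs').
  by rewrite -mcompA uE mcompA wE vE.
Qed.

End Slopes.

(** * Transfer to the category of filtrations *)

Section FullSubcategory.
Variables (C : preadditive) (P : C -> Prop).
Implicit Types X Y Z : full_subcategory P.

Lemma full_kernel X Y K (f : mor X Y) (k : mor K X) :
  is_kernel (incl_mor f) (incl_mor k) -> is_kernel f k.
Proof. by case=> e U; split=> // T g; apply: U. Qed.

Lemma full_cokernel X Y Q (f : mor X Y) (q : mor Y Q) :
  is_cokernel (incl_mor f) (incl_mor q) -> is_cokernel f q.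
Proof. by case=> e U; split=> // T g; apply: U. Qed.

End FullSubcategory.

Theorem theoremA (L : porderZmodType)
  (L_ordered : totally_ordered_group L) (L_divisible : uniquely_divisible L)
  (A : preadditive) (A_quasi_abelian : quasi_abelian A)
  (rk : A -> nat) (deg : A -> L)
  (rk_rank : rank_function rk) (deg_degree : degree_function deg)
  (slope_slope : slope_function (slope rk deg))
  (M N : WApre L A) (f : mor M N)
  (M_udq : udq (slope rk deg) M) (N_uds : uds (slope rk deg) N) :
  strict f /\
  (forall (Q : WApre L A) (q : mor N Q), is_cokernel f q ->
     is_cokernel (incl_mor f) (incl_mor q) /\ uds (slope rk deg) Q) /\
  (forall (K : WApre L A) (k : mor K M), is_kernel f k ->
     udq (slope rk deg) K).
Proof.
pose a : nat_trans (sval M) (sval N) := f.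
have [[bM Mb] Mk] := filtration_constant_off L_ordered A_quasi_abelian (svalP M).
have [[bN Nb] Nk] := filtration_constant_off L_ordered A_quasi_abelian (svalP N).
(* A common list of breaks for [M] and [N], hence also for the kernel, cokernel and image. *)
pose b := bM ++ bN.
have {}Mb : constant_off b (sval M).
  by apply: constant_off_sub Mb => w wb; rewrite mem_cat wb.
have {}Nb : constant_off b (sval N).
  by apply: constant_off_sub Nb => w wb; rewrite mem_cat wb orbT.
have Mge x (B : A) (p : mor (sval M x) B) : gr_proj p -> quotients_ge rk deg x B.
  move=> /(gr_proj_is_gr L_ordered A_quasi_abelian Mb) gB Q q qe.
  have [Q0|Qn] := pselect (is_zero Q).
    by case/andP: (zero_deg_bounds rk_rank deg_degree x Q0).
  by rewrite -(le_slopeE L_ordered L_divisible) //; exact: (M_udq x B gB Q q qe).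
have Nle x (B : A) (p : mor (sval N x) B) : gr_proj p -> subobjects_le rk deg x B.
  move=> /(gr_proj_is_gr L_ordered A_quasi_abelian Nb) gB S s sm.
  have [S0|Sn] := pselect (is_zero S).
    by case/andP: (zero_deg_bounds rk_rank deg_degree x S0).
  by rewrite -(slope_leE L_ordered L_divisible) //; exact: (N_uds x B gB S s sm).
have [K0 [k0 hk0]] := functor_kernel A_quasi_abelian a.
have [Q0 [q0 hq0]] := functor_cokernel A_quasi_abelian a.
have [I0 [i0 hi0]] := functor_kernel A_quasi_abelian q0.
have Kb := kernel_constant_off Mb Nb hk0.
have Qb := cokernel_constant_off Mb Nb hq0.
have Ib := kernel_constant_off Nb Qb hi0.
have Kk := kernel_some_kernel A_quasi_abelian Mk hk0.
have Ik := kernel_some_kernel A_quasi_abelian Nk hi0.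
have Qk := kernels_of_predecessors L_ordered A_quasi_abelian Qb
  (cokernel_predecessor L_ordered L_divisible A_quasi_abelian rk_rank deg_degree
    slope_slope
     Mb Nb Mk Nk Mge Nle hq0).
pose K : WApre L A :=
  exist _ (K0 : Fun L A) (constant_off_filtration L_ordered A_quasi_abelian Kb Kk).
pose Q : WApre L A :=
  exist _ (Q0 : Fun L A) (constant_off_filtration L_ordered A_quasi_abelian Qb Qk).
pose I : WApre L A :=
  exist _ (I0 : Fun L A) (constant_off_filtration L_ordered A_quasi_abelian Ib Ik).
pose k : mor K M := k0; pose q : mor N Q := q0; pose i : mor I N := i0.
have hk : is_kernel f k by apply/full_kernel/pointwise_kernel.
have hqF : is_cokernel (incl_mor f) (incl_mor q) by apply: pointwise_cokernel.
have hq : is_cokernel f q by apply: full_cokernel.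
have hi : is_kernel q i by apply/full_kernel/pointwise_kernel.
have [p pE] := kernel_lift hi (cokernel_comp0 hq).
split; [|split].
(* One object [I] serves as coimage and image; what remains is that [p] is a cokernel of [k], which
   follows pointwise from the strictness of each [a x]. *)
- exists I, p, I, i, (idm I); split; last exact: idm_iso; last by rewrite mcompm1.
    exists K, k; split=> //; apply/full_cokernel/pointwise_cokernel => x.
    have pEx : i0 x \c nt (p : nat_trans _ _) x = a x.
      exact: (congr1 (fun u : nat_trans _ _ => u x) pE).
    have [sfx _] :=
      strict_below_all L_ordered L_divisible A_quasi_abelian rk_rank deg_degree
      slope_slope a Mb Nb Mk Nk Mge Nle x.
    have [D [d hd]] := strictly_factored_image A_quasi_abelian sfx (hq0 x) (hi0 x) pEx.
    apply: (cokernel_of_kernel hd); apply: kernelI.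
    + apply: (mono_eq0 (kernel_mono (hi0 x))).
      by rewrite mcompA pEx (kernel_comp0 (hk0 x)).
    + exact: kernel_mono (hk0 x).
    + move=> T g pg; apply: (kernel_lift (hk0 x)).
      by rewrite -pEx -mcompA pg mcompm0.
  by exists Q, q.
(* Any cokernel among filtrations is isomorphic to the pointwise one, so it inherits the universal
   property in [Fun] and the slope bounds. *)
- move=> Q' q' hq'; have [u [v [vu uv]] uE] := cokernel_unique hq hq'.
  have ui : @is_iso (Fun L A) _ _ (incl_mor u) by exists (incl_mor v).
  have hq'F : is_cokernel (incl_mor f) (incl_mor q').
    by rewrite -uE; apply: (cokernel_iso hqF ui).
  split=> // x G /is_gr_gr_proj [s gs] S t tm Sn.
  rewrite (slope_leE L_ordered L_divisible) //.
  have hq'x y : is_cokernel (a y) (nt (q' : nat_trans _ _) y).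
    by rewrite -uE; apply: (cokernel_iso (hq0 y) (fun_iso_pointwise ui y)).
  exact: (cokernel_gr_le L_ordered L_divisible A_quasi_abelian rk_rank deg_degree
    slope_slope
    Mb Nb Mge Nle hq'x gs tm).
- move=> K' k' hk'; have [u [v [vu uv]] uE] := kernel_unique hk hk'.
  have ui : @is_iso (Fun L A) _ _ (incl_mor u) by exists (incl_mor v).
  move=> x G /is_gr_gr_proj [s gs] S t te Sn.
  rewrite (le_slopeE L_ordered L_divisible) //.
  have hk'x y : is_kernel (a y) (nt (k' : nat_trans _ _) y).
    by rewrite -uE; apply: (kernel_iso (hk0 y) (fun_iso_pointwise ui y)).
  exact: (kernel_gr_ge L_ordered L_divisible A_quasi_abelian rk_rank deg_degree
    slope_slope
    Mb Nb Mk Nk Mge Nle hk'x gs te).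
Qed.
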